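(* Let $X=\{X_t,\ t\ge 0\}$ be a real-valued process with $X_0=0$, independent increments, continuous in probability, with càdlàg paths, such that $\mathbb{E}[X_t]=0$ and $\mathbb{E}[|X_t|^k]<\infty$ for all $t\ge 0$ and all $k\ge 1$. For $t\ge 0$ let $\sigma_t^2$ be the variance of the Gaussian part of the infinitely divisible law of $X_t$ and $\nu_t$ its Lévy measure, and set $$F_2(t)=\sigma_t^2+\int_{\mathbb{R}\setminus\{0\}}x^2\,\nu_t(dx),\qquad F_n(t)=\int_{\mathbb{R}\setminus\{0\}}x^n\,\nu_t(dx),\ n\ge 3.$$ Then for every $n\ge 1$ the process $$M^{(n)}_t=\Gamma_n\big(X_t,-F_2(t),\dots,-F_n(t)\big),\qquad t\ge 0,$$ is a martingale with respect to the natural filtration of $X$.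
   Context: The Kendall polynomials $\Gamma_n(x_1,\dots,x_n)$, $n\ge 1$, are the polynomials expressing moments in terms of cumulants: they are defined by the formal power series identity $$\exp\Big\{\sum_{n=1}^\infty \kappa_n\frac{u^n}{n!}\Big\}=\sum_{n=0}^\infty \Gamma_n(\kappa_1,\dots,\kappa_n)\frac{u^n}{n!},$$ with $\Gamma_0=1$ (so e.g. $\Gamma_1(x_1)=x_1$, $\Gamma_2(x_1,x_2)=x_1^2+x_2$, $\Gamma_3(x_1,x_2,x_3)=x_1^3+3x_1x_2+x_3$). Under the hypotheses, $\int_{|x|>1}|x|\,\nu_t(dx)<\infty$ and $\int|x|^n\nu_t(dx)<\infty$ for all $n\ge2$, and $F_n(t)$ is the $n$-th cumulant of $X_t$ for $n\ge 2$. *)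

(* Defs.v *)
From HB Require Import structures.
From mathcomp Require Import all_boot all_order all_algebra.
From mathcomp Require Import all_classical all_reals all_analysis.
Set Implicit Arguments. Unset Strict Implicit. Unset Printing Implicit Defensive.
Import Order.TTheory GRing.Theory Num.Theory.
Import numFieldNormedType.Exports.
Local Open Scope classical_set_scope.
Local Open Scope ring_scope.

(* Kendall polynomial Gamma_n evaluated at (kappa 1, ..., kappa n):
   n! times the coefficient of u^n in exp(sum_{k>=1} kappa_k u^k / k!).
   Since the exponent has no constant term, only the first n+1 terms of the
   exponential series and the first n terms of the exponent contribute. *)
Definition kendall (R : fieldType) (n : nat) (kappa : nat -> R) : R :=
  let p : {poly R} :=
    \poly_(k < n.+1) (if k == 0%N then 0 else kappa k / (k`!)%:R) in
  (n`!)%:R * (\sum_(j < n.+1) (((j`!)%:R)^-1 *: p ^+ j)) `_ n.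

Definition natural_filtration d (T : measurableType d) (R : realType)
  (X : R -> T -> R) (s : R) : set (set T) :=
  <<s setT, [set A | exists r (B : set R),
     [/\ 0 <= r <= s, measurable B & A = X r @^-1` B] ] >>.

Definition martingale d (T : measurableType d) (R : realType)
  (P : probability T R) (X : R -> T -> R) (M : R -> T -> R) : Prop :=
  (forall t, 0 <= t -> forall B : set R, measurable B ->
      natural_filtration X t (M t @^-1` B)) /\
  (forall t, 0 <= t -> P.-integrable setT (fun w => (M t w)%:E)) /\
  (forall s t, 0 <= s -> s <= t -> forall A, natural_filtration X s A ->
      (\int[P]_(w in A) (M t w)%:E = \int[P]_(w in A) (M s w)%:E)%E).

Definition indep_increments d (T : measurableType d) (R : realType)
  (P : probability T R) (X : R -> T -> R) : Prop :=
  forall (n : nat) (t : nat -> R) (B : nat -> set R),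
    0 <= t 0%N -> (forall i, (i < n)%N -> t i < t i.+1) ->
    (forall i, measurable (B i)) ->
    P (\big[setI/setT]_(i < n) [set w | B i (X (t i.+1) w - X (t i) w)]) =
    (\prod_(i < n) P [set w | B i (X (t i.+1) w - X (t i) w)%R])%E.

Definition cont_in_prob d (T : measurableType d) (R : realType)
  (P : probability T R) (X : R -> T -> R) : Prop :=
  forall t e eta : R, 0 <= t -> 0 < e -> 0 < eta ->
    exists2 delta : R, 0 < delta & forall s : R, 0 <= s -> `|s - t| < delta ->
      (P [set w | (e < `|X s w - X t w|)%R] < eta%:E)%E.

Definition cadlag (R : realType) (f : R -> R) : Prop :=
  forall t, 0 <= t ->
    f x @[x --> t^'+] --> f t /\ (0 < t -> cvg (f x @[x --> t^'-])).

Definition levy_measure (R : realType) (nu : {measure set R -> \bar R}) :=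
  nu [set 0] = 0%E /\ (\int[nu]_x (Num.min 1 (x ^+ 2))%:E < +oo)%E.

(* (b, s2, nu) is the Levy-Khintchine triple of the law of Y:
   E[exp(i u Y)] = exp(i b u - s2 u^2/2
                      + int (e^{iux} - 1 - i u x 1_{|x|<=1}) nu(dx)),
   written via real and imaginary parts. *)
Definition LK_triple d (T : measurableType d) (R : realType)
  (P : probability T R) (Y : T -> R) (b s2 : R)
  (nu : {measure set R -> \bar R}) : Prop :=
  0 <= s2 /\ levy_measure nu /\
  forall u : R,
    let re := - s2 * u ^+ 2 / 2
              + Rintegral nu (~` [set 0]) (fun x => cos (u * x) - 1) in
    let im := b * u
              + Rintegral nu (~` [set 0])
                  (fun x : R => sin (u * x) - (if `|x| <= 1 then u * x else 0)) in
    Rintegral P setT (fun w => cos (u * Y w)) = expR re * cos im /\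
    Rintegral P setT (fun w => sin (u * Y w)) = expR re * sin im.

Definition Fcum (R : realType) (s2 : R -> R) (nu : R -> {measure set R -> \bar R})
  (k : nat) (t : R) : R :=
  if k == 2%N then s2 t + Rintegral (nu t) (~` [set 0]) (fun x => x ^+ 2)
  else Rintegral (nu t) (~` [set 0]) (fun x => x ^+ k).

(* Main.v *)
Require Import Defs.
From HB Require Import structures.
From mathcomp Require Import all_boot all_order all_algebra.
From mathcomp Require Import all_classical all_reals all_analysis.
From mathcomp Require Import measurable_realfun complex ring lra.
Import Order.TTheory GRing.Theory Num.Theory.
Import numFieldNormedType.Exports.
Local Open Scope classical_set_scope.
Local Open Scope ring_scope.

(** By the Levy-Khintchine formula the cumulants of X_t are F_n(t), so that, modulo any
    power of u, exp(sum_(n >= 2) F_n(t) u^n/n!) is the moment generating series m_t(u) and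
    M^(n)_t is n! times the coefficient of u^n in exp(u X_t) / m_t(u).  As X_t - X_s is
    independent of the past up to s, m_t = m_s z with z the moment generating series of
    X_t - X_s, and the expectation of exp(u X_t) / m_t(u) on an event of the past is that of
    exp(u X_s) z(u) / m_t(u) = exp(u X_s) / m_s(u).

    The moments of the Levy measure are not assumed finite.  The modulus of the
    characteristic function is exp(re u) and has Taylor expansions of every order at 0.  By
    induction on k, re is an even polynomial plus or minus r(u), the integral of the
    nonnegative Taylor remainder of cos(u x) of order 2k, and dominated convergence gives
    r(u) = o(u^(2k-2)).  Being even and expandable, r is then O(u^2k), and Fatou's lemma
    yields the moment of order 2k.  The cumulants are finally identified by comparing the
    Taylor coefficients of both sides of the Levy-Khintchine formula. *)

Set Implicit Arguments. Unset Strict Implicit. Unset Printing Implicit Defensive.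

(** * Truncated exponentials of polynomials *)

(** Both sides run over the pairs with a + b < N, on the left along the diagonals n = a + b. *)
Lemma triangular_sum (V : nmodType) (G : nat -> nat -> V) (N : nat) :
  \sum_(n < N) \sum_(a < n.+1) G a (n - a)%N =
  \sum_(a < N) \sum_(b < N - a) G a b.
Proof.
elim: N => [|N IH]; first by rewrite !big_ord0.
rewrite big_ord_recr/= IH [in RHS]big_ord_recr/= subSnn big_ord1.
rewrite [X in _ + X]big_ord_recr/= subnn addrA -big_split/=; congr (_ + _).
by apply: eq_bigr => a _; rewrite subSn 1?ltnW ?ltn_ord// big_ord_recr.
Qed.

Section eqX.
Context {F : fieldType}.
Implicit Types p q r : {poly F}.

(** Congruence modulo X^N: truncated power series are handled as polynomials up to this relation. *)
Definition eqX (N : nat) p q := forall i, (i < N)%N -> p`_i = q`_i.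

Lemma eqX_refl N p : eqX N p p. Proof. by []. Qed.

Lemma eqX_sym N p q : eqX N p q -> eqX N q p.
Proof. by move=> h i /h. Qed.

Lemma eqX_trans N q p r : eqX N p q -> eqX N q r -> eqX N p r.
Proof. by move=> h k i iN; rewrite h// k. Qed.

Lemma eqXD N p p' q q' : eqX N p p' -> eqX N q q' -> eqX N (p + q) (p' + q').
Proof. by move=> h k i iN; rewrite !coefD h// k. Qed.

Lemma eqXM N p p' q q' : eqX N p p' -> eqX N q q' -> eqX N (p * q) (p' * q').
Proof.
move=> h k i iN; rewrite !coefM; apply: eq_bigr => j _.
by rewrite h ?k// (leq_ltn_trans _ iN)// ?leq_subr// -ltnS.
Qed.

Lemma coefX_low p j i : p`_0 = 0 -> (i < j)%N -> (p ^+ j)`_i = 0.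
Proof.
move=> p0; elim: j i => // j IH i ij; rewrite exprS coefM big1// => a _.
have [a0|a0] := posnP a; first by rewrite a0 p0 mul0r.
rewrite IH ?mulr0// ltn_subLR; last by rewrite -ltnS.
by rewrite (leq_trans ij)// -add1n leq_add2r.
Qed.

Lemma coefM_low p q a b i : (forall j, (j < a)%N -> p`_j = 0) ->
  (forall j, (j < b)%N -> q`_j = 0) -> (i < a + b)%N -> (p * q)`_i = 0.
Proof.
move=> pa qb iab; rewrite coefM big1// => j _.
have [ja|aj] := ltnP j a; first by rewrite pa// mul0r.
rewrite qb ?mulr0// ltn_subLR; last by rewrite -ltnS.
by rewrite (leq_trans iab)// leq_add2r.
Qed.

(** Truncated exponential generating series of m; the constant sequence 1 gives the exponential
    series. *)
Definition egf (N : nat) (m : nat -> F) : {poly F} := \poly_(j < N) (m j / j`!%:R).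

Definition texp (N : nat) p := egf N (fun=> 1) \Po p.

Lemma texpE N p : texp N p = \sum_(j < N) j`!%:R^-1 *: p ^+ j.
Proof.
rewrite /texp /egf poly_def raddf_sum/=; apply: eq_bigr => j _.
by rewrite comp_polyZ comp_Xn_poly div1r.
Qed.

(** By the binomial formula (p + q)^n / n! is the sum of the p^a / a! q^b / b! with a + b = n. The
    product on the right has further terms, with a + b >= N, but these have valuation at least N. *)
Lemma texpD N p q : (forall n : nat, (n.+1)%:R != 0 :> F) ->
  p`_0 = 0 -> q`_0 = 0 -> eqX N (texp N (p + q)) (texp N p * texp N q).
Proof.
move=> char0 p0 q0 i iN.
have nz n : (n`!)%:R != 0 :> F by have := fact_gt0 n; case: (n`!).
pose G a b := (a`!%:R^-1 *: p ^+ a) * (b`!%:R^-1 *: q ^+ b).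
have -> : texp N (p + q) = \sum_(a < N) \sum_(b < N - a) G a b.
  rewrite -triangular_sum texpE; apply: eq_bigr => n _.
  rewrite addrC exprDn scaler_sumr; apply: eq_bigr => a _.
  have an : (a <= n)%N by rewrite -ltnS.
  rewrite /G -scalerAl -scalerAr scalerA -scaler_nat scalerA [q ^+ _ * _]mulrC.
  congr (_ *: _); have := bin_fact an => /(congr1 (fun k => k%:R : F)).
  rewrite !natrM => e; have := nz n; rewrite -e !mulf_eq0 !negb_or => /and3P[c0 x0 y0].
  by field; rewrite c0 x0 y0.
rewrite !texpE mulr_suml !coef_sum; apply: eq_bigr => a _.
(* The triangle a + b < N is widened to the full square; the added terms vanish below degree N. *)
rewrite mulr_sumr !coef_sum (big_ord_widen N (fun b => (G a b)`_i)) ?leq_subr//.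
rewrite big_mkcond/=; apply: eq_bigr => b _; case: ltnP => // Nab.
rewrite -scalerAl -scalerAr !coefZ (@coefM_low _ _ a b) ?mulr0//.
- by move=> j; exact: coefX_low.
- by move=> j; exact: coefX_low.
- by rewrite (leq_trans iN)// -leq_subLR.
Qed.

Lemma texp0 N : (0 < N)%N -> texp N 0 = 1 :> {poly F}.
Proof.
case: N => // N _; rewrite texpE big_ord_recl/= expr0 fact0 invr1 scale1r.
by rewrite big1 ?addr0// => i _; rewrite expr0n/= scaler0.
Qed.

Lemma texpZX N (x : F) : texp N (x *: 'X) = egf N (fun j => x ^+ j).
Proof.
rewrite texpE /egf poly_def; apply: eq_bigr => j _.
by rewrite exprZn scalerA mulrC.
Qed.

Lemma eqX_texp N p q : p`_0 = 0 -> eqX N p q -> eqX N (texp N p) (texp N q).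
Proof.
move=> p0 pq; rewrite !texpE => i iN; rewrite !coef_sum; apply: eq_bigr => j _.
rewrite !coefZ; congr (_ * _); elim: (j : nat) i iN => // n IH i iN.
by rewrite !exprS; apply: (eqXM pq IH).
Qed.

(** Even part of the generating polynomial of m at iX; [sinP] is the odd part divided by i. For m
    constant equal to 1 they are the Taylor polynomials of cosine and sine. *)
Definition cosP (k : nat) (m : nat -> F) : {poly F} :=
  \sum_(j < k) ((-1) ^+ j * m j.*2 / (j.*2)`!%:R) *: 'X^(j.*2).
Definition sinP (k : nat) (m : nat -> F) : {poly F} :=
  \sum_(j < k) ((-1) ^+ j * m j.*2.+1 / (j.*2.+1)`!%:R) *: 'X^(j.*2.+1).

(** Formal Euler formula: the exponents are split by parity and i^2 = -1 produces the signs. *)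
Lemma egf_comp_i (i : F) k m : i ^+ 2 = -1 ->
  egf k.*2 m \Po (i *: 'X) = cosP k m + i *: sinP k m.
Proof.
move=> i2; rewrite /cosP /sinP /egf poly_def raddf_sum/= scaler_sumr -big_split/=.
elim: k => [|k IH]; first by rewrite !big_ord0.
rewrite doubleS !big_ord_recr/= IH -!addrA; congr (_ + (_ + _)).
  rewrite comp_polyZ comp_Xn_poly exprZn scalerA; congr (_ *: _).
  by rewrite -muln2 mulnC exprM i2 mulrC mulrA.
rewrite comp_polyZ comp_Xn_poly exprZn !scalerA; congr (_ *: _).
rewrite exprS -[in i ^+ _]muln2 mulnC exprM i2; ring.
Qed.

Lemma coef_cosP0 k m : m 0%N = 0 -> (cosP k m)`_0 = 0.
Proof.
move=> m0; rewrite coef_sum big1// => j _; rewrite coefZ coefXn.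
by case: (j : nat) => [|n]; rewrite ?m0 ?mulr0 ?mul0r//= mulr0.
Qed.

Lemma coef_sinP0 k m : (sinP k m)`_0 = 0.
Proof. by rewrite coef_sum big1// => j _; rewrite coefZ coefXn mulr0. Qed.

Lemma coef_comp_scaleX p (c : F) i : (p \Po (c *: 'X))`_i = c ^+ i * p`_i.
Proof.
rewrite comp_polyE coef_sum.
under eq_bigr do rewrite exprZn !coefZ coefXn mulrCA.
have [ip|pi] := ltnP i (size p).
  rewrite (bigD1 (Ordinal ip))//= eqxx mulr1 big1 ?addr0//.
  by move=> j; rewrite -val_eqE/= eq_sym => /negPf ->; rewrite !mulr0.
rewrite [p`_i]nth_default// mulr0 big1// => j _.
by rewrite gtn_eqF ?mulr0 ?mulr0// (leq_trans (ltn_ord j)).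
Qed.

End eqX.

(* Read over R[i], the two real identities say that the generating polynomial of m
   and the exponential of that of f agree after the substitution X := i X. *)
Lemma egf_texp_of_cos_sin (R : rcfType) (k : nat) (m f : nat -> R) : f 0%N = 0 ->
  eqX k.*2 (cosP k m)
    (texp k.*2 (cosP k f) * (cosP k (fun=> 1) \Po sinP k f)) ->
  eqX k.*2 (sinP k m)
    (texp k.*2 (cosP k f) * (sinP k (fun=> 1) \Po sinP k f)) ->
  eqX k.*2 (egf k.*2 m) (texp k.*2 (egf k.*2 f)).
Proof.
move=> f0 hc hs.
pose ii : R[i] := 'i; pose io : {rmorphism R -> R[i]} := real_complex R.
have i2 : ii ^+ 2 = -1 by rewrite sqrCi.
have map_egf N g : map_poly io (egf N g) = egf N (io \o g).
  by apply/polyP => n; rewrite coef_map !coef_poly/=; case: ifP => _;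
     rewrite ?raddf0// fmorph_div rmorph_nat.
have map_egfi g : map_poly io (cosP k g) + ii *: map_poly io (sinP k g) =
    map_poly io (egf k.*2 g) \Po (ii *: 'X).
  rewrite map_egf egf_comp_i// /cosP /sinP !rmorph_sum/=.
  congr (_ + ii *: _); apply: eq_bigr => j _;
  by rewrite map_polyZ map_polyXn/= fmorph_div rmorphM rmorph_nat rmorph_sign.
have map_texp N p : map_poly io (texp N p) = texp N (map_poly io p).
  by rewrite /texp map_comp_poly map_egf; congr (egf _ _ \Po _);
     apply/funext => ?; rewrite /= rmorph1.
have map_eqX p q : eqX k.*2 p q -> eqX k.*2 (map_poly io p) (map_poly io q).
  by move=> h i ik; rewrite !coef_map h.
(* The substitution multiplies the coefficient of index j by i^j, which is nonzero, so it can be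
   undone. *)
suff h : eqX k.*2 (map_poly io (egf k.*2 m) \Po (ii *: 'X))
                  (map_poly io (texp k.*2 (egf k.*2 f)) \Po (ii *: 'X)).
  move=> j jk; have := h _ jk; rewrite !coef_comp_scaleX !coef_map/=.
  have ii0 : ii ^+ j != 0 by rewrite expf_neq0// -sqrf_eq0 i2 oppr_eq0 oner_eq0.
  by move=> /(mulfI ii0)/(fmorph_inj io).
rewrite -map_egfi map_texp /texp -comp_polyA -map_egfi -/(texp _ _).
set A := cosP k f; set B := sinP k f.
have tD : eqX k.*2 (texp k.*2 (map_poly io A + ii *: map_poly io B))
    (texp k.*2 (map_poly io A) * texp k.*2 (ii *: map_poly io B)).
  apply: texpD; first by move=> n; rewrite pnatr_eq0.
    by rewrite coef_map coef_cosP0.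
  by rewrite coefZ coef_map coef_sinP0 mulr0.
apply: eqX_trans (eqX_sym tD).
(* exp(iB) = cos B + i sin B: the Euler formula for the constant sequence 1, composed with B. *)
have -> : texp k.*2 (ii *: map_poly io B) =
   map_poly io (cosP k (fun=> 1) \Po B) + ii *: map_poly io (sinP k (fun=> 1) \Po B).
  rewrite !map_comp_poly -comp_polyZ -comp_polyD map_egfi map_egf -comp_polyA.
  by rewrite comp_polyZ comp_polyX /texp; congr (egf _ _ \Po _);
     apply/funext => ?; rewrite /= rmorph1.
rewrite mulrDr -scalerAr -map_texp -!rmorphM/=.
apply: eqXD; first exact: map_eqX.
by move=> i ik; rewrite !coefZ (map_eqX _ _ hs i ik).
Qed.

(** * Taylor expansions at 0 *)

Section expansions.
Context {R : realType}.
Implicit Types (f g : R -> R) (p q t : {poly R}) (N k : nat).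

Definition bigO0 N f := exists C : R, \forall u \near (0 : R), `|f u| <= C * `|u| ^+ N.

Lemma bigO0_ext N f g : f =1 g -> bigO0 N f -> bigO0 N g.
Proof.
by move=> fg [C fC]; exists C; near=> u; rewrite -fg; near: u.
Unshelve. all: by end_near. Qed.

Lemma bigO0P N f : bigO0 N f ->
  exists2 C : R, 0 <= C & \forall u \near (0 : R), `|f u| <= C * `|u| ^+ N.
Proof.
move=> [C fC]; exists `|C| => //; near=> u.
have /le_trans -> // : `|f u| <= C * `|u| ^+ N by near: u.
by rewrite ler_wpM2r ?exprn_ge0// ler_norm.
Unshelve. all: by end_near. Qed.

Lemma bigO0D N f g : bigO0 N f -> bigO0 N g -> bigO0 N (fun u => f u + g u).
Proof.
move=> [C fC] [D gD]; exists (C + D); near=> u.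
by rewrite (le_trans (ler_normD _ _))// mulrDl lerD//; near: u.
Unshelve. all: by end_near. Qed.

Lemma bigO0Z N f (c : R) : bigO0 N f -> bigO0 N (fun u => c * f u).
Proof.
move=> [C fC]; exists (`|c| * C); near=> u.
by rewrite normrM -mulrA ler_wpM2l//; near: u.
Unshelve. all: by end_near. Qed.

Lemma bigO0B N f g : bigO0 N f -> bigO0 N g -> bigO0 N (fun u => f u - g u).
Proof.
move=> hf /(bigO0Z (-1)) hg; apply: bigO0_ext (bigO0D hf hg) => u.
by rewrite mulN1r.
Qed.

Lemma bigO0M N M f g : bigO0 N f -> bigO0 M g -> bigO0 (N + M) (fun u => f u * g u).
Proof.
move=> /bigO0P[C C0 fC] /bigO0P[D D0 gD]; exists (C * D); near=> u.
by rewrite normrM exprD mulrACA ler_pM//; near: u.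
Unshelve. all: by end_near. Qed.

Lemma near0_le (e : R) : 0 < e -> \forall u \near (0 : R), `|u| <= e.
Proof.
move=> e0; near=> u; rewrite -[u]subr0 distrC.
by near: u; apply: cvgr_dist_le.
Unshelve. all: by end_near. Qed.

Lemma bigO0_le N M f : (N <= M)%N -> bigO0 M f -> bigO0 N f.
Proof.
move=> NM /bigO0P[C C0 fC]; exists C; near=> u.
have /le_trans -> // : `|f u| <= C * `|u| ^+ M by near: u.
by rewrite ler_wpM2l// ler_wiXn2l//; near: u; exact: near0_le.
Unshelve. all: by end_near. Qed.

Lemma bigO0_horner N p : (forall i, (i < N)%N -> p`_i = 0) -> bigO0 N (horner p).
Proof.
move=> pN; exists (\sum_(i < size p) `|p`_i|); near=> u.
have u1 : `|u| <= 1 by near: u; exact: near0_le.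
rewrite horner_coef (le_trans (ler_norm_sum _ _ _))// mulr_suml ler_sum// => i _.
rewrite normrM normrX; have [iN|Ni] := ltnP i N.
  by rewrite pN// normr0 !mul0r.
by rewrite ler_wpM2l// ler_wiXn2l.
Unshelve. all: by end_near. Qed.

(** Taylor expansion without derivatives: it passes to products and compositions directly, and it
    determines the coefficients of p below N, the others being arbitrary. *)
Definition expand N f p := bigO0 N (fun u => f u - p.[u]).

Lemma expand_ext N f g p : f =1 g -> expand N f p -> expand N g p.
Proof. by move=> fg; apply: bigO0_ext => u; rewrite fg. Qed.

Lemma expand_horner N p : expand N (horner p) p.
Proof.
by exists 0; near=> u; rewrite subrr normr0 mul0r.
Unshelve. all: by end_near. Qed.

Lemma expand_bigO N f p : expand N f p -> bigO0 0 f.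
Proof.
move=> fp; apply: bigO0_ext (bigO0D (bigO0_le (leq0n N) fp) (@bigO0_horner 0 p _)) => // u.
by rewrite subrK.
Qed.

Lemma expandD N f g p q : expand N f p -> expand N g q ->
  expand N (fun u => f u + g u) (p + q).
Proof.
move=> fp gq; apply: bigO0_ext (bigO0D fp gq) => u.
by rewrite hornerD opprD addrACA.
Qed.

(** The error is (f - p) g + p (g - q), where g and p are bounded near 0. *)
Lemma expandM N f g p q : expand N f p -> expand N g q ->
  expand N (fun u => f u * g u) (p * q).
Proof.
move=> fp gq; have h1 := bigO0M fp (expand_bigO gq).
have h2 : bigO0 N (fun u => p.[u] * (g u - q.[u])).
  exact: (bigO0M (@bigO0_horner 0 p _) gq).
rewrite addn0 in h1; apply: bigO0_ext (bigO0D h1 h2) => u /=.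
rewrite hornerM; ring.
Qed.

Lemma expandX N f p n : expand N f p -> expand N (fun u => f u ^+ n) (p ^+ n).
Proof.
move=> fp; elim: n => [|n IH].
  by apply: expand_ext (expand_horner N 1) => u; rewrite hornerC.
by rewrite exprS; apply: expand_ext (expandM fp IH) => u; rewrite exprS.
Qed.

Lemma expand_horner_comp N t f p : expand N f p -> expand N (fun u => t.[f u]) (t \Po p).
Proof.
move=> fp; elim/poly_ind: t => [|t c IH].
  by rewrite comp_poly0; apply: expand_ext (expand_horner N 0) => u; rewrite !hornerC.
rewrite comp_polyD comp_polyM comp_polyX comp_polyC.
apply: expand_ext (expandD (expandM IH fp) (expand_horner N c%:P)) => u.
by rewrite !hornerE.
Qed.

(** Since p has no constant term, f(u) = O(u). Hence f tends to 0, where the expansion of g is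
    valid, and an error O(f(u)^N) is O(u^N). *)
Lemma expand_comp N f g p t : (0 < N)%N -> expand N g t -> expand N f p -> p`_0 = 0 ->
  expand N (fun u => g (f u)) (t \Po p).
Proof.
move=> N0 /bigO0P[C C0 gt] fp p0.
have [D D0 fD] : exists2 D : R, 0 <= D & \forall u \near (0 : R), `|f u| <= D * `|u|.
  apply: (@bigO0P 1); have h i : (i < 1)%N -> p`_i = 0 by case: i.
  apply: bigO0_ext (bigO0D (bigO0_le N0 fp) (bigO0_horner h)) => u /=.
  by rewrite subrK.
have f0 : f u @[u --> (0 : R)] --> (0 : R).
  apply/cvgr0Pnorm_le => e e0; near=> u.
  have /le_trans -> // : `|f u| <= D * `|u| by near: u.
  (* The divisor 1 + D stays positive when D = 0. *)
  have ue : `|u| <= e / (1 + D).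
    by near: u; apply: near0_le; rewrite divr_gt0// ltr_pwDl.
  rewrite ler_pdivlMr ?ltr_pwDl// in ue; rewrite (le_trans _ ue)//.
  by rewrite mulrC ler_wpM2l// lerDr.
have gft : bigO0 N (fun u => g (f u) - t.[f u]).
  have gtf : \forall u \near (0 : R), `|g (f u) - t.[f u]| <= C * `|f u| ^+ N := f0 _ gt.
  exists (C * D ^+ N); near=> u.
  have /le_trans -> // : `|g (f u) - t.[f u]| <= C * `|f u| ^+ N by near: u.
  rewrite -mulrA -exprMn ler_wpM2l// lerXn2r ?nnegrE ?mulr_ge0//.
  by near: u.
apply: bigO0_ext (bigO0D gft (expand_horner_comp t fp)) => u /=.
by rewrite addrA subrK.
Unshelve. all: by end_near. Qed.

(** Smallness along the single sequence 1/(n+1) suffices, which suits limits of integrals taken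
    along a sequence. The constant coefficient is a limit, hence 0; then p is divided by X. *)
Lemma littleo_harmonic_coef0 (M : nat) p :
  (fun n => p.[harmonic n] / (harmonic n : R) ^+ M) @ \oo --> (0 : R) ->
  forall i, (i <= M)%N -> p`_i = 0.
Proof.
have hX (q : {poly R}) : (fun n => q.[harmonic n]) @ \oo --> q`_0.
  rewrite -horner_coef0; apply: continuous_cvg; last exact: cvg_harmonic.
  exact: continuous_horner.
elim: M p => [|M IH] p hp.
  move=> i; rewrite leqn0 => /eqP ->.
  have e : (fun n => p.[harmonic n] / (harmonic n : R) ^+ 0) = (fun n => p.[harmonic n]).
    by apply/funext => n; rewrite expr0 divr1.
  by rewrite e in hp; rewrite -(cvg_lim _ (hX p))//; apply: cvg_lim.
have p0 : p`_0 = 0.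
  rewrite -(cvg_lim _ (hX p))//; apply: cvg_lim => //.
  have := cvgM hp (hX 'X^(M.+1)); rewrite coefXn mulr0.
  move=> H0; apply: cvg_trans (H0 _); apply: near_eq_cvg; near=> n.
  by rewrite /= hornerXn divfK// expf_neq0// gt_eqF// (@harmonic_gt0 R).
have pE : p = drop_poly 1 p * 'X.
  apply/polyP => -[|i]; rewrite coefMX//= coef_drop_poly addn1//.
move=> [|i] iM //; rewrite pE coefMX/=; apply: IH => //.
apply: cvg_trans hp; apply: near_eq_cvg; near=> n.
rewrite [in LHS]pE hornerMX exprS; set h := harmonic n.
have h0 : h != 0 by rewrite gt_eqF// harmonic_gt0.
by rewrite invfM mulrA mulfK.
Unshelve. all: by end_near. Qed.

(** Along the harmonic sequence, O(u^(N+1)) is in particular o(u^N). *)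
Lemma bigO0_coef0 N p : bigO0 N (horner p) -> forall i, (i < N)%N -> p`_i = 0.
Proof.
case: N => // N /bigO0P[C C0 pC] i; rewrite ltnS; move: i.
have pCh : \forall n \near \oo, `|p.[harmonic n]| <= C * `|harmonic n| ^+ N.+1.
  exact: (@cvg_harmonic R _ pC).
apply: littleo_harmonic_coef0; apply/cvgr0Pnorm_le => e e0; near=> n.
have h0 : 0 < harmonic n :> R by exact: harmonic_gt0.
have hpC : `|p.[harmonic n]| <= C * `|harmonic n| ^+ N.+1 by near: n.
have hle : harmonic n <= e / (1 + C).
  near: n; have /cvgr0_norm_le := @cvg_harmonic R; move=> /(_ (e / (1 + C))).
  rewrite divr_gt0 ?ltr_pwDl// => /(_ isT); apply: filterS => n.
  by rewrite ger0_norm ?harmonic_ge0.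
rewrite normrM normfV normrX (gtr0_norm h0) ler_pdivrMr ?exprn_gt0//.
rewrite (le_trans hpC)// (gtr0_norm h0) exprS mulrA ler_wpM2r ?exprn_ge0 ?(ltW h0)//.
rewrite ler_pdivlMr ?ltr_pwDl// in hle; rewrite (le_trans _ hle)//.
by rewrite mulrC ler_wpM2l ?(ltW h0)// lerDr.
Unshelve. all: by end_near. Qed.

Lemma expand_uniq N f p q : expand N f p -> expand N f q -> eqX N p q.
Proof.
move=> fp fq i iN; apply/eqP; rewrite -subr_eq0 -coefB; apply/eqP.
move: i iN; apply: bigO0_coef0; apply: bigO0_ext (bigO0B fq fp) => u.
by rewrite hornerD hornerN; ring.
Qed.

Lemma eq_expand N f p q : eqX N p q -> expand N f p -> expand N f q.
Proof.
move=> pq fp; have h i : (i < N)%N -> (p - q)`_i = 0.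
  by move=> iN; rewrite coefB pq// subrr.
apply: bigO0_ext (bigO0D fp (bigO0_horner h)) => u /=.
by rewrite hornerD hornerN; ring.
Qed.

End expansions.

(** * Taylor remainders of cosine, sine and the exponential *)

Section taylor_remainders.
Context {R : realType}.
Implicit Types (y : R) (k N : nat).

Lemma fact_scale (a : R) n : a / n.+1`!%:R * n.+1%:R = a / n`!%:R.
Proof. by rewrite factS natrM invfM mulrA mulrAC divfK// pnatr_eq0. Qed.

Lemma deriv_egfS N (m : nat -> R) : (egf N.+1 m)^`() = egf N (fun j => m j.+1).
Proof.
apply/polyP => i; rewrite coef_deriv !coef_poly ltnS; case: ifP => // _; last by rewrite mul0rn.
by rewrite -[LHS]mulr_natr fact_scale.
Qed.

Lemma egf_horner0 N (m : nat -> R) : (egf N.+1 m).[0] = m 0%N.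
Proof. by rewrite horner_coef0 coef_poly/= fact0 divr1. Qed.

Lemma deriv_sinP k : (sinP k (fun=> 1 : R))^`() = cosP k (fun=> 1).
Proof.
rewrite /sinP /cosP raddf_sum/=; apply: eq_bigr => j _.
by rewrite derivZ derivXn/= -scalerMnr scalerMnl -[X in X *: _]mulr_natr fact_scale.
Qed.

Lemma deriv_cosP k : (cosP k.+1 (fun=> 1 : R))^`() = - sinP k (fun=> 1).
Proof.
rewrite /sinP /cosP big_ord_recl/= derivD derivZ derivXn/= mulr0n scaler0 add0r.
rewrite raddf_sum/= -sumrN; apply: eq_bigr => j _.
rewrite /bump/= add1n doubleS derivZ derivXn/= -scalerMnr scalerMnl -scaleNr.
by rewrite -[X in X *: _ = _]mulr_natr fact_scale exprS mulN1r !mulNr.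
Qed.

(* The sign makes both remainders nonnegative on [0, +oo[ for k > 0. *)
Definition cosR k y := (-1) ^+ k * (cos y - (cosP k (fun=> 1)).[y]).
Definition sinR k y := (-1) ^+ k * (sin y - (sinP k (fun=> 1)).[y]).

Lemma sign_sqr k : (-1) ^+ k * (-1) ^+ k = 1 :> R.
Proof. by rewrite -expr2 sqrr_sign. Qed.

(** Algebra shared by the two recursions below, s being the sign (-1)^k. *)
Lemma alternating_step (s c h f z : R) : s * s = 1 ->
  -1 * s * (c - (h + s * 1 / f * z)) = z / f - s * (c - h).
Proof. by move=> s2; transitivity (s * s * (z / f) - s * (c - h)); [ring|rewrite s2 mul1r]. Qed.

(** Two consecutive remainders add up to a Taylor term. So nonnegativity of one bounds the other,
    and integrating this identity extracts one moment at a time. *)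
Lemma cosRS k y : cosR k.+1 y = y ^+ k.*2 / k.*2`!%:R - cosR k y.
Proof.
rewrite /cosR /cosP big_ord_recr/= hornerD hornerZ hornerXn exprS.
exact/alternating_step/sign_sqr.
Qed.

Lemma sinRS k y : sinR k.+1 y = y ^+ k.*2.+1 / k.*2.+1`!%:R - sinR k y.
Proof.
rewrite /sinR /sinP big_ord_recr/= hornerD hornerZ hornerXn exprS.
exact/alternating_step/sign_sqr.
Qed.

Lemma is_derive_horner (p : {poly R}) y : is_derive y 1 (horner p) (p^`()).[y].
Proof. by apply: DeriveDef; [exact: derivable_horner|rewrite -derive1E derivE]. Qed.

Lemma is_derive_sinR k y : is_derive y 1 (sinR k) (cosR k y).
Proof.
have := @is_derive_horner (sinP k (fun=> 1)) y; rewrite deriv_sinP => h.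
have -> : sinR k = (-1) ^+ k \*: (@sin R - horner (sinP k (fun=> 1))) by [].
exact: is_deriveZ.
Qed.

Lemma is_derive_cosR k y : is_derive y 1 (cosR k.+1) (sinR k y).
Proof.
have := @is_derive_horner (cosP k.+1 (fun=> 1)) y; rewrite deriv_cosP => h.
have -> : cosR k.+1 = (-1) ^+ k.+1 \*: (@cos R - horner (cosP k.+1 (fun=> 1))) by [].
apply: is_derive_eq.
by rewrite /sinR exprS hornerN /GRing.scale/=; ring.
Qed.

Lemma derive_ge0 (f f' : R -> R) : (forall y, is_derive y 1 f (f' y)) ->
  (forall y, 0 <= y -> 0 <= f' y) -> f 0 = 0 -> forall y, 0 <= y -> 0 <= f y.
Proof.
move=> df f'0 f0 y y0.
have cf : {within `[0, y], continuous f}.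
  by apply: derivable_within_continuous => x _; exact: ex_derive.
have [x] := @MVT_segment R f f' 0 y y0 (fun x _ => df x) cf.
rewrite f0 !subr0 in_itv/= => /andP[x0 _] ->.
by rewrite mulr_ge0// f'0.
Qed.

(** The remainders are successive antiderivatives of one another vanishing at 0, starting from 1 -
    cos, which is nonnegative. *)
Lemma cosR_sinR_ge0 k y : 0 <= y -> 0 <= cosR k.+1 y /\ 0 <= sinR k.+1 y.
Proof.
have s0 j : sinR j.+1 0 = 0.
  by rewrite /sinR sin0 horner_coef0 coef_sinP0 subrr mulr0.
have c0 j : cosR j.+1 0 = 0.
  rewrite /cosR cos0 horner_coef0 /cosP big_ord_recl coefD coefZ coefXn/=.
  rewrite coef_sum big1 => [|i _]; last by rewrite coefZ coefXn mulr0.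
  by rewrite addr0 expr0 fact0 invr1 !mulr1 subrr mulr0.
suff H : (forall z, 0 <= z -> 0 <= cosR k.+1 z) /\ (forall z, 0 <= z -> 0 <= sinR k.+1 z).
  by move=> y0; split; [apply: H.1|apply: H.2].
elim: k => [|k [_ IH]].
  have h z : 0 <= z -> 0 <= cosR 1 z.
    move=> z0; rewrite cosRS /cosR /cosP big_ord0 horner0 expr0 fact0 subr0.
    by rewrite !mul1r invr1 subr_ge0 cos_le1.
  by split => //; apply: derive_ge0 h (s0 0%N) => x; exact: is_derive_sinR.
have h : forall z, 0 <= z -> 0 <= cosR k.+2 z.
  by apply: derive_ge0 IH (c0 _) => x; exact: is_derive_cosR.
by split => //; apply: derive_ge0 h (s0 _) => x; exact: is_derive_sinR.
Qed.

Lemma cosRN k y : cosR k (- y) = cosR k y.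
Proof.
rewrite /cosR cosN /cosP !horner_sum; congr (_ * (_ - _)).
apply: eq_bigr => j _; rewrite !hornerZ !hornerXn.
by rewrite -muln2 mulnC !exprM sqrrN.
Qed.

Lemma sinRN k y : sinR k (- y) = - sinR k y.
Proof.
have h : (sinP k (fun=> 1 : R)).[- y] = - (sinP k (fun=> 1)).[y].
  rewrite /sinP !horner_sum -sumrN; apply: eq_bigr => j _.
  have e : (- y) ^+ j.*2.+1 = - y ^+ j.*2.+1.
    by rewrite exprNn -signr_odd/= odd_double expr1 mulN1r.
  by rewrite !hornerZ !hornerXn e mulrN.
by rewrite /sinR sinN h -opprD mulrN.
Qed.

Lemma cosR_ge0 k y : 0 <= cosR k.+1 y.
Proof.
have [y0|/ltW y0] := leP 0 y; first by case: (cosR_sinR_ge0 k y0).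
by rewrite -cosRN; case: (@cosR_sinR_ge0 k (- y)) => //; rewrite oppr_ge0.
Qed.

Lemma cosR_le k y : cosR k y <= y ^+ k.*2 / k.*2`!%:R.
Proof. by have := cosR_ge0 k y; rewrite cosRS subr_ge0. Qed.

Lemma cosR_norm_le k y : `|cosR k.+1 y| <= y ^+ k.+1.*2 / k.+1.*2`!%:R.
Proof. by rewrite ger0_norm ?cosR_ge0 ?cosR_le. Qed.

Lemma sinR_norm_le k y : `|sinR k.+1 y| <= `|y| ^+ k.+1.*2.+1 / k.+1.*2.+1`!%:R.
Proof.
wlog y0 : y / 0 <= y.
  move=> h; have [/h//|/ltW y0] := leP 0 y.
  by rewrite -normrN -sinRN -[`|y|]normrN h// oppr_ge0.
rewrite (ger0_norm y0) ger0_norm; last by case: (cosR_sinR_ge0 k y0).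
by case: (cosR_sinR_ge0 k.+1 y0) => _; rewrite sinRS subr_ge0.
Qed.

Lemma cosRE k y : cos y = (cosP k (fun=> 1)).[y] + (-1) ^+ k * cosR k y.
Proof.
by rewrite /cosR mulrA sign_sqr mul1r addrC subrK.
Qed.

Lemma sinRE k y : sin y = (sinP k (fun=> 1)).[y] + (-1) ^+ k * sinR k y.
Proof.
by rewrite /sinR mulrA sign_sqr mul1r addrC subrK.
Qed.

Lemma ge1_factV n : (n`!%:R : R)^-1 <= 1.
Proof. by rewrite invf_le1 ?ltr0n ?fact_gt0// ler1n fact_gt0. Qed.

Lemma expand_cos k : expand k.+1.*2 (@cos R) (cosP k.+1 (fun=> 1)).
Proof.
exists 1; near=> u; rewrite (cosRE k.+1) addrC addKr normrM normr_sign !mul1r.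
rewrite (le_trans (cosR_norm_le _ _))// -[leRHS]mulr1 ler_pM ?ge1_factV ?invr_ge0//.
  by rewrite exprn_even_ge0// odd_double.
by rewrite -normrX ler_norm.
Unshelve. all: by end_near. Qed.

Lemma expand_sin k : expand k.+1.*2 (@sin R) (sinP k.+1 (fun=> 1)).
Proof.
apply: (@bigO0_le _ _ k.+1.*2.+1) => //.
exists 1; near=> u; rewrite (sinRE k.+1) addrC addKr normrM normr_sign !mul1r.
by rewrite (le_trans (sinR_norm_le _ _))// -[leRHS]mulr1 ler_pM ?ge1_factV ?invr_ge0 ?exprn_ge0.
Unshelve. all: by end_near. Qed.

(** Induction by the mean value theorem, the remainder of order N being the derivative of that of
    order N + 1. The factorial is given up, as only the order of magnitude matters. *)
Lemma expR_remainder_le N y : `|y| <= 1 ->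
  `|expR y - (egf N (fun=> 1)).[y]| <= expR 1 * `|y| ^+ N.
Proof.
elim: N y => [|N IH] y y1.
  have -> : egf 0 (fun=> 1 : R) = 0 by apply/polyP => i; rewrite coef_poly coef0.
  rewrite horner0 subr0 expr0 mulr1 ger0_norm ?expR_ge0// ler_expR.
  exact: le_trans (ler_norm _) y1.
pose f (z : R) := expR z - (egf N.+1 (fun=> 1)).[z].
pose f' (z : R) := expR z - (egf N (fun=> 1)).[z].
have df (z : R) : is_derive z 1 f (f' z).
  have := @is_derive_horner (egf N.+1 (fun=> 1)) z; rewrite deriv_egfS => h.
  by have -> : f = @expR R - horner (egf N.+1 (fun=> 1)) by []; exact: is_deriveB.
have f0 : f 0 = 0 by rewrite /f expR0 egf_horner0 subrr.
have cf (a b : R) : {within `[a, b], continuous f}.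
  by apply: derivable_within_continuous => z _; exact: ex_derive.
suff [z zy fyE] : exists2 z, `|z| <= `|y| & f y = f' z * y.
  rewrite -/(f y) fyE normrM exprSr mulrA ler_wpM2r//.
  rewrite (le_trans (IH z _))//; first exact: le_trans zy y1.
  by rewrite ler_wpM2l ?expR_ge0// lerXn2r ?nnegrE.
have [y0|/ltW y0] := leP 0 y.
  have [z] := @MVT_segment R f f' 0 y y0 (fun x _ => df x) (cf _ _).
  rewrite f0 !subr0 in_itv/= => /andP[z0 zy] ->; exists z => //.
  by rewrite !ger0_norm.
have [z] := @MVT_segment R f f' y 0 y0 (fun x _ => df x) (cf _ _).
rewrite f0 !sub0r in_itv/= => /andP[yz z0] e; exists z.
  by rewrite !ler0_norm// lerN2.
by apply: oppr_inj; rewrite e mulrN.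
Qed.

Lemma expand_expR N : expand N (@expR R) (egf N (fun=> 1)).
Proof.
exists (expR 1); near=> u; apply: expR_remainder_le.
by near: u; exact: near0_le.
Unshelve. all: by end_near. Qed.

(** Brings an estimate on exp(y) back to y without a logarithm. It follows from exp(y) >= 1 + y at y
    and at -y; the bound 1/2 ensures exp(-y) <= 2. *)
Lemma expR_sub1_ge y : `|expR y - 1| <= 2^-1 -> `|y| <= 2 * `|expR y - 1|.
Proof.
move=> h; have := h; rewrite ler_norml => /andP[h1 h2].
have e1 : y <= expR y - 1 by rewrite lerBrDl expR_ge1Dx.
have [y0|y0] := leP 0 y.
  rewrite !ger0_norm//; last exact: le_trans e1.
  by rewrite (le_trans e1)// ler_peMl ?ler1n// (le_trans y0).
have e2 : - y <= expR (- y) - 1 by rewrite lerBrDl expR_ge1Dx.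
have E : expR (- y) <= 2.
  rewrite expRN -[2]invrK lef_pV2 ?posrE ?expR_gt0 ?invr_gt0//; lra.
have e3 : expR (- y) - 1 = expR (- y) * (1 - expR y).
  by rewrite mulrBr mulr1 -expRD addNr expR0.
have yl1 : expR y <= 1 by rewrite -[leRHS]expR0 ler_expR ltW.
rewrite (ltr0_norm y0) (le_trans e2)// e3 ler0_norm ?subr_le0// opprB.
by rewrite ler_wpM2r// subr_ge0.
Qed.

Lemma expR_sub1_le y : `|y| <= 1 -> `|expR y - 1| <= expR 1 * `|y|.
Proof.
move=> /(expR_remainder_le 1); rewrite expr1.
by have -> : egf 1 (fun=> 1 : R) = 1%:P; [
  apply/polyP => -[|i]; rewrite coef_poly coefC//= fact0 divr1|rewrite hornerC].
Qed.

End taylor_remainders.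

(** * Integrals of Taylor remainders *)

Section real_integrable.
Context d (T : measurableType d) (R : realType).
Variables (mu : {measure set T -> \bar R}) (D : set T) (mD : measurable D).
Implicit Types f g : T -> R.

Lemma integrable_le f g : measurable_fun D f -> (forall x, D x -> `|f x| <= g x) ->
  mu.-integrable D (EFin \o g) -> mu.-integrable D (EFin \o f).
Proof.
move=> mf fg ig; apply: le_integrable ig => //; first exact/measurable_EFinP.
by move=> x Dx /=; rewrite lee_fin (le_trans (fg x Dx))// ler_norm.
Qed.

Lemma integrable_scale f (c : R) : mu.-integrable D (EFin \o f) ->
  mu.-integrable D (EFin \o (fun x => c * f x)).
Proof. by move=> /(integrableZl mD c). Qed.

Lemma integrable_add f g : mu.-integrable D (EFin \o f) -> mu.-integrable D (EFin \o g) ->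
  mu.-integrable D (EFin \o (fun x => f x + g x)).
Proof. by move=> fi gi; exact: (integrableD mD fi gi). Qed.

Lemma integrable_sub f g : mu.-integrable D (EFin \o f) -> mu.-integrable D (EFin \o g) ->
  mu.-integrable D (EFin \o (fun x => f x - g x)).
Proof. by move=> fi gi; exact: (integrableB mD fi gi). Qed.

Lemma integrable_sum_seq (I : Type) (s : seq I) (f : I -> T -> R) :
  (forall i, mu.-integrable D (EFin \o f i)) ->
  mu.-integrable D (EFin \o (fun x => \sum_(i <- s) f i x)) /\
  Rintegral mu D (fun x => \sum_(i <- s) f i x) = \sum_(i <- s) Rintegral mu D (f i).
Proof.
move=> fi; elim: s => [|i s [IH1 IH2]].
  have e : (fun x : T => \sum_(i <- [::]) f i x) = cst 0.
    by apply/funext => x; rewrite big_nil.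
  rewrite e big_nil Rintegral_cst// mul0r; split => //.
  exact: integrable0.
have e : (fun x : T => \sum_(j <- i :: s) f j x) = (fun x => f i x + \sum_(j <- s) f j x).
  by apply/funext => x; rewrite big_cons.
by rewrite e big_cons RintegralD// IH2; split => //; exact: integrable_add.
Qed.

Lemma normr_integrable f : mu.-integrable D (EFin \o f) ->
  mu.-integrable D (EFin \o (fun x => `|f x|)).
Proof. by move=> fi; exact: (integrable_abse fi). Qed.

Lemma Rintegral_norm_le f g (c : R) : measurable_fun D f ->
  (forall x, D x -> `|f x| <= c * g x) -> mu.-integrable D (EFin \o g) ->
  `|Rintegral mu D f| <= c * Rintegral mu D g.
Proof.
move=> mf fg ig; have cg := integrable_scale c ig.
have fi := integrable_le mf fg cg.
rewrite (le_trans (le_normr_Rintegral mD fi))// -RintegralZl//.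
by apply: le_Rintegral => //; exact: normr_integrable.
Qed.

End real_integrable.

Section trig_integrals.
Context d (T : measurableType d) (R : realType).
Variables (mu : {measure set T -> \bar R}) (D : set T) (mD : measurable D).
Variables (Y : T -> R) (mY : measurable_fun D Y).

Lemma measurable_cosR k (u : R) : measurable_fun D (fun x => cosR k (u * Y x)).
Proof.
apply: (@measurableT_comp _ _ _ _ _ _ (cosR k)); last exact: measurable_funM.
apply: measurable_funM => //; apply: measurable_funB.
  by apply: continuous_measurable_fun => x; exact: continuous_cos.
by apply: continuous_measurable_fun => x; exact: continuous_horner.
Qed.

Lemma measurable_sinR k (u : R) : measurable_fun D (fun x => sinR k (u * Y x)).
Proof.
apply: (@measurableT_comp _ _ _ _ _ _ (sinR k)); last exact: measurable_funM.
apply: measurable_funM => //; apply: measurable_funB.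
  by apply: continuous_measurable_fun => x; exact: continuous_sin.
by apply: continuous_measurable_fun => x; exact: continuous_horner.

Qed.

(** The recursion [cosRS] is integrated from a up to k. The start is a = 0 for a probability law,
    where the cosine itself is integrable, and a = 1 for a Levy measure, where only 1 - cos is; m
    vanishes below a so that [cosP] sees the available moments alone. *)
Lemma Rintegral_cosR a k (u : R) (m : nat -> R) : (a <= k)%N ->
  mu.-integrable D (EFin \o (fun x => cosR a (u * Y x))) ->
  (forall j, (a <= j < k)%N -> mu.-integrable D (EFin \o (fun x => Y x ^+ j.*2))) ->
  (forall j, (j < a)%N -> m j.*2 = 0) ->
  (forall j, (a <= j)%N -> m j.*2 = Rintegral mu D (fun x => Y x ^+ j.*2)) ->
  mu.-integrable D (EFin \o (fun x => cosR k (u * Y x))) /\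
  (-1) ^+ a * Rintegral mu D (fun x => cosR a (u * Y x)) =
  (cosP k m).[u] + (-1) ^+ k * Rintegral mu D (fun x => cosR k (u * Y x)).
Proof.
move=> ak ia iY m0 mE; elim: k ak iY => [|k IH] ak iY.
  by move: ak ia; rewrite leqn0 => /eqP -> ia; rewrite /cosP big_ord0 horner0 add0r.
have [ka|ak'] := leqP a k; last first.
  have ek : k.+1 = a by apply/eqP; rewrite eqn_leq ak' ak.
  rewrite ek /cosP horner_sum big1 ?add0r// => j _.
  by rewrite m0// mulr0 mul0r hornerZ mul0r.
have [|ik Ek] := IH ka.
  by move=> j /andP[aj jk]; apply: iY; rewrite aj ltnS ltnW.
have iYk : mu.-integrable D (EFin \o (fun x => Y x ^+ k.*2)) by apply: iY; rewrite ka ltnSn.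
have e : (fun x => cosR k.+1 (u * Y x)) =
    (fun x => u ^+ k.*2 / k.*2`!%:R * Y x ^+ k.*2 - cosR k (u * Y x)).
  by apply/funext => x; rewrite cosRS exprMn; ring.
have iZ := integrable_scale mD (u ^+ k.*2 / k.*2`!%:R) iYk.
rewrite e; split; first exact: integrable_sub.
rewrite RintegralB// RintegralZl// Ek /cosP big_ord_recr/= hornerD hornerZ hornerXn mE//.
by rewrite exprS; ring.
Qed.

Lemma Rintegral_sinR a k (u : R) (m : nat -> R) : (a <= k)%N ->
  mu.-integrable D (EFin \o (fun x => sinR a (u * Y x))) ->
  (forall j, (a <= j < k)%N -> mu.-integrable D (EFin \o (fun x => Y x ^+ j.*2.+1))) ->
  (forall j, (j < a)%N -> m j.*2.+1 = 0) ->
  (forall j, (a <= j)%N -> m j.*2.+1 = Rintegral mu D (fun x => Y x ^+ j.*2.+1)) ->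
  mu.-integrable D (EFin \o (fun x => sinR k (u * Y x))) /\
  (-1) ^+ a * Rintegral mu D (fun x => sinR a (u * Y x)) =
  (sinP k m).[u] + (-1) ^+ k * Rintegral mu D (fun x => sinR k (u * Y x)).
Proof.
move=> ak ia iY m0 mE; elim: k ak iY => [|k IH] ak iY.
  by move: ak ia; rewrite leqn0 => /eqP -> ia; rewrite /sinP big_ord0 horner0 add0r.
have [ka|ak'] := leqP a k; last first.
  have ek : k.+1 = a by apply/eqP; rewrite eqn_leq ak' ak.
  rewrite ek /sinP horner_sum big1 ?add0r// => j _.
  by rewrite m0// mulr0 mul0r hornerZ mul0r.
have [|ik Ek] := IH ka.
  by move=> j /andP[aj jk]; apply: iY; rewrite aj ltnS ltnW.
have iYk : mu.-integrable D (EFin \o (fun x => Y x ^+ k.*2.+1)) by apply: iY; rewrite ka ltnSn.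
have e : (fun x => sinR k.+1 (u * Y x)) =
    (fun x => u ^+ k.*2.+1 / k.*2.+1`!%:R * Y x ^+ k.*2.+1 - sinR k (u * Y x)).
  by apply/funext => x; rewrite sinRS exprMn; ring.
have iZ := integrable_scale mD (u ^+ k.*2.+1 / k.*2.+1`!%:R) iYk.
rewrite e; split; first exact: integrable_sub.
rewrite RintegralB// RintegralZl// Ek /sinP big_ord_recr/= hornerD hornerZ hornerXn mE//.
by rewrite [(-1) ^+ k.+1]exprS; ring.
Qed.

(** The error is the integral of the remainder of order 2k + 2, at most u^(2k+2) times the moment of
    that order. *)
Lemma expand_Rintegral_cosR a k (m : nat -> R) : (a <= k.+1)%N ->
  (forall u : R, mu.-integrable D (EFin \o (fun x => cosR a (u * Y x)))) ->
  (forall j, (a <= j)%N -> mu.-integrable D (EFin \o (fun x => Y x ^+ j.*2))) ->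
  (forall j, (j < a)%N -> m j.*2 = 0) ->
  (forall j, (a <= j)%N -> m j.*2 = Rintegral mu D (fun x => Y x ^+ j.*2)) ->
  expand k.+1.*2 (fun u => (-1) ^+ a * Rintegral mu D (fun x => cosR a (u * Y x)))
    (cosP k.+1 m).
Proof.
move=> ak ia iY m0 mE; exists (Rintegral mu D (fun x => Y x ^+ k.+1.*2)); near=> u.
have iY' j : (a <= j < k.+1)%N -> mu.-integrable D (EFin \o (fun x => Y x ^+ j.*2)).
  by case/andP => aj _; exact: iY.
have [ik ->] := Rintegral_cosR ak (ia u) iY' m0 mE.
rewrite addrC addKr normrM normr_sign mul1r mulrC.
apply: Rintegral_norm_le => //; [exact: measurable_cosR| |exact: iY].
move=> x Dx; rewrite (le_trans (cosR_norm_le _ _))// exprMn.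
rewrite -[u ^+ _]ger0_norm ?exprn_even_ge0 ?odd_double// normrX.
rewrite -[leRHS]mulr1 ler_pM ?ge1_factV ?invr_ge0//.
by apply: mulr_ge0; [exact: exprn_ge0|rewrite exprn_even_ge0 ?odd_double].
Unshelve. all: by end_near. Qed.

Lemma expand_Rintegral_sinR a k (m : nat -> R) : (a <= k.+1)%N ->
  (forall u : R, mu.-integrable D (EFin \o (fun x => sinR a (u * Y x)))) ->
  (forall j, (a <= j)%N -> mu.-integrable D (EFin \o (fun x => Y x ^+ j.*2.+1))) ->
  (forall j, (j < a)%N -> m j.*2.+1 = 0) ->
  (forall j, (a <= j)%N -> m j.*2.+1 = Rintegral mu D (fun x => Y x ^+ j.*2.+1)) ->
  expand k.+1.*2 (fun u => (-1) ^+ a * Rintegral mu D (fun x => sinR a (u * Y x)))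
    (sinP k.+1 m).
Proof.
move=> ak ia iY m0 mE; apply: (@bigO0_le _ _ k.+1.*2.+1) => //.
exists (Rintegral mu D (fun x => `|Y x ^+ k.+1.*2.+1|)); near=> u.
have iY' j : (a <= j < k.+1)%N -> mu.-integrable D (EFin \o (fun x => Y x ^+ j.*2.+1)).
  by case/andP => aj _; exact: iY.
have [ik ->] := Rintegral_sinR ak (ia u) iY' m0 mE.
rewrite addrC addKr normrM normr_sign mul1r mulrC.
apply: Rintegral_norm_le => //; [exact: measurable_sinR| |].
  move=> x Dx; rewrite (le_trans (sinR_norm_le _ _))// normrM exprMn normrX.
  by rewrite -[leRHS]mulr1 ler_pM ?ge1_factV ?invr_ge0// mulr_ge0 ?exprn_ge0.
exact/normr_integrable/iY.
Unshelve. all: by end_near. Qed.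

End trig_integrals.

(** * Orders of magnitude at 0 and integrability of even powers *)

Lemma cvg0_squeeze (R : realType) (f b : nat -> R) :
  (\forall n \near \oo, `|f n| <= b n) -> b @ \oo --> (0 : R) -> f @ \oo --> (0 : R).
Proof.
move=> fb b0; apply: (@squeeze_cvgr _ _ _ _ (fun n => - b n) b); last first.
- exact: b0.
- by rewrite -oppr0; exact: cvgN.
- by apply: filterS fb => n; rewrite ler_norml.
Qed.

Lemma near_harmonic (R : realType) (P : R -> Prop) :
  (\forall u \near (0 : R), P u) -> \forall n \near \oo, P (harmonic n).
Proof. by move=> h; exact: (@cvg_harmonic R _ h). Qed.

Lemma harmonic_le1 (R : realType) n : (harmonic n : R) <= 1.
Proof. by rewrite /= invf_le1// ler1n. Qed.

(** As s = o(u^2k), the polynomial h - 1 has no coefficient up to degree 2k, and evenness removes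
    degree 2k + 1. So exp(s) - 1 = O(u^(2k+2)), and s is of the same order. *)
Lemma bigO0_log_even (R : realType) (s : R -> R) k (h : {poly R}) :
  (forall u, s (- u) = s u) ->
  expand k.+1.*2 (fun u => expR (s u)) h ->
  (fun n => s (harmonic n) / (harmonic n : R) ^+ k.*2) @ \oo --> (0 : R) ->
  bigO0 k.+1.*2 s.
Proof.
move=> sN sh s0.
(* Since s is even, h(-u) is an expansion of the same function, and uniqueness gives h_i = -h_i for
   odd i. *)
have even_h i : odd i -> (i < k.+1.*2)%N -> h`_i = 0.
  move=> oi ik; have sh' : expand k.+1.*2 (fun u => expR (s u)) (h \Po (-1 *: 'X)).
    have [C hC] := sh; exists C.
    have hC' : \forall u \near (0 : R),
        `|expR (s (- u)) - h.[- u]| <= C * `|- u| ^+ k.+1.*2.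
      by apply/(nearN _ (fun u => `|expR (s u) - h.[u]| <= C * `|u| ^+ k.+1.*2)); rewrite oppr0.
    near=> u; rewrite horner_comp hornerZ hornerX mulN1r -sN -[`|u|]normrN.
    by near: u.
  have := expand_uniq sh sh' ik; rewrite coef_comp_scaleX -signr_odd oi expr1 mulN1r.
  by move=> /eqP; rewrite -subr_eq0 opprK -mulr2n mulrn_eq0/= => /eqP.
have [C C0 hC] := bigO0P sh.
have h1 i : (i <= k.*2)%N -> (h - 1)`_i = 0.
  apply: littleo_harmonic_coef0.
  (* The bound comes from h - 1 = (exp(s) - 1) - (exp(s) - h): the first part is at most e |s|, and
     the second, at most C u^(2k+2), leaves at most C u after division by u^2k because u <= 1. *)
  apply: (@cvg0_squeeze _ _ (fun n => C * harmonic n + expR 1 *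
     `|s (harmonic n) / (harmonic n : R) ^+ k.*2|)); last first.
    rewrite -[X in _ --> X]addr0; apply: cvgD.
      by rewrite -(mulr0 C); apply: cvgMr; exact: cvg_harmonic.
    rewrite -(mulr0 (expR 1)); apply: cvgMr.
    by have := cvg_norm s0; rewrite normr0; apply.
  near=> n.
  have : `|expR (s (harmonic n)) - h.[harmonic n]| <= C * `|harmonic n| ^+ k.+1.*2.
    by near: n; exact: (near_harmonic hC).
  have : `|s (harmonic n) / harmonic n ^+ k.*2| <= 1.
    by near: n; exact: cvgr0_norm_le.
  have u0 : 0 < harmonic n :> R by exact: harmonic_gt0.
  have u1 : harmonic n <= 1 :> R by exact: harmonic_le1.
  move: u0 u1; set u : R := harmonic n => u0 u1 sn hCn.
  have s1 : `|s u| <= 1.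
    move: sn; rewrite normrM normfV normrX (gtr0_norm u0) ler_pdivrMr ?exprn_gt0// mul1r.
    by move=> /le_trans; apply; rewrite exprn_ile1// ltW.
  rewrite hornerD hornerN hornerC !normrM normfV normrX (gtr0_norm u0).
  rewrite ler_pdivrMr ?exprn_gt0// mulrDl mulrA divfK ?gt_eqF ?exprn_gt0//.
  have -> : h.[u] - 1 = (expR (s u) - 1) - (expR (s u) - h.[u]) by ring.
  rewrite (le_trans (ler_normB _ _))// addrC lerD ?expR_sub1_le//.
  rewrite (le_trans hCn)// (gtr0_norm u0) doubleS -mulrA ler_wpM2l//.
  by rewrite !exprS ler_wpM2l ?(ltW u0)// ler_piMl// exprn_ge0 ?(ltW u0).
have h1' i : (i < k.+1.*2)%N -> (h - 1)`_i = 0.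
  rewrite doubleS !ltnS leq_eqVlt ltnS => /predU1P[->|/h1//].
  by rewrite coefB coefC/= subr0 even_h//= ?odd_double// doubleS.
have H1 : bigO0 k.+1.*2 (fun u => expR (s u) - 1).
  apply: bigO0_ext (bigO0D sh (bigO0_horner h1')) => u /=.
  by rewrite hornerD hornerN hornerC addrA subrK.
have [E E0 hE] := bigO0P H1.
exists (2 * E); near=> u.
have hEu : `|expR (s u) - 1| <= E * `|u| ^+ k.+1.*2 by near: u.
rewrite -mulrA; apply: le_trans (expR_sub1_ge _) _; last by rewrite ler_wpM2l.
rewrite (le_trans hEu)//.
have u1 : `|u| <= 1 by near: u; exact: near0_le.
(* This makes E |u|^(2k+2) at most 1/2, as [expR_sub1_ge] demands. *)
have uE : `|u| <= 2^-1 / (1 + E).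
  by near: u; apply: near0_le; rewrite divr_gt0// ltr_pwDl.
rewrite ler_pdivlMr ?ltr_pwDl// in uE; rewrite (le_trans _ uE)// mulrC.
rewrite ler_pM ?exprn_ge0// ?lerDr// doubleS exprS ler_piMr//.
by rewrite exprn_ile1.
Unshelve. all: by end_near. Qed.

(** The remainder is O(u^(2k+2)) for fixed y. This pointwise limit serves both dominated convergence
    and Fatou's lemma below. *)
Lemma cvg_cosR_quot (R : realType) k (y : R) :
  (fun n => cosR k.+1 (harmonic n * y) / (harmonic n : R) ^+ k.*2) @ \oo --> (0 : R).
Proof.
have hn0 n : 0 < (harmonic n : R) by exact: harmonic_gt0.
apply: (@cvg0_squeeze _ _ (fun n => y ^+ k.+1.*2 * harmonic n)); last first.
  by rewrite -[X in _ --> X](mulr0 (y ^+ k.+1.*2)); apply: cvgMr; exact: cvg_harmonic.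
near=> n; rewrite ger0_norm ?divr_ge0 ?exprn_ge0 ?cosR_ge0 ?(ltW (hn0 _))//.
rewrite ler_pdivrMr ?exprn_gt0//.
rewrite (le_trans (cosR_le _ _))// ler_pdivrMr ?ltr0n ?fact_gt0//.
have Yk0 : 0 <= y ^+ k.+1.*2 by rewrite exprn_even_ge0 ?odd_double.
rewrite (@le_trans _ _ (y ^+ k.+1.*2 * harmonic n * harmonic n ^+ k.*2))//.
  rewrite exprMn mulrC -mulrA ler_wpM2l// doubleS !exprS ler_wpM2l ?(ltW (hn0 _))//.
  by rewrite ler_piMl ?exprn_ge0 ?(ltW (hn0 _)) ?harmonic_le1.
apply: ler_peMr; last by rewrite ler1n fact_gt0.
by rewrite mulr_ge0 ?(mulr_ge0 Yk0) ?exprn_ge0 ?(ltW (hn0 _)).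
Unshelve. all: by end_near. Qed.

Section levy_moments.
Context d (T : measurableType d) (R : realType).
Variables (mu : {measure set T -> \bar R}) (D : set T) (mD : measurable D).
Variables (Y : T -> R) (mY : measurable_fun D Y).

(** Dominated convergence for the remainder divided by u^2k, with dominating function g. *)
Lemma cvg_Rintegral_cosR k (g : T -> R) : mu.-integrable D (EFin \o g) ->
  (forall u x, 0 < u -> u <= 1 -> D x -> cosR k.+1 (u * Y x) <= u ^+ k.*2 * g x) ->
  (fun n => Rintegral mu D (fun x => cosR k.+1 (harmonic n * Y x)) /
            (harmonic n : R) ^+ k.*2) @ \oo --> (0 : R).
Proof.
move=> ig cg.
pose f n x : R := cosR k.+1 (harmonic n * Y x) / (harmonic n) ^+ k.*2.
have f0 n x : 0 <= f n x.
  by rewrite divr_ge0 ?exprn_ge0 ?harmonic_ge0// cosR_ge0.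
have hn0 n : 0 < (harmonic n : R) by exact: harmonic_gt0.
have fg n x : D x -> f n x <= g x.
  by move=> Dx; rewrite /f ler_pdivrMr ?exprn_gt0// [g x * _]mulrC cg ?harmonic_le1.
have mf n : measurable_fun D (f n).
  by apply: measurable_funM => //; exact: measurable_cosR.
have fcvg x : (fun n => f n x) @ \oo --> (0 : R) by exact: cvg_cosR_quot.
have fE n :
    Rintegral mu D (fun x => cosR k.+1 (harmonic n * Y x)) / (harmonic n : R) ^+ k.*2 =
    fine (\int[mu]_(x in D) (f n x)%:E)%E.
  rewrite -RintegralZr//.
  apply: (integrable_le mD _ _ (integrable_scale mD (harmonic n ^+ k.*2) ig)).
    exact: measurable_cosR.
  by move=> x Dx; rewrite ger0_norm ?cosR_ge0 ?cg ?harmonic_le1.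
under eq_fun do rewrite fE.
apply: fine_cvg => /=.
have -> : 0%:E = (\int[mu]_(x in D) (cst 0%E : T -> \bar R) x)%E by rewrite integral0.
have [|||||_ _ //] := @dominated_convergence _ _ _ mu D mD
  (fun n x => (f n x)%:E) (cst 0%E) (EFin \o g).
- by move=> n; exact/measurable_EFinP.
- exact: measurable_cst.
- by apply: aeW => x _; apply: cvg_EFin; [exact: nearW|exact: fcvg].
- exact: ig.
- by apply: aeW => x n Dx /=; rewrite lee_fin ger0_norm// fg.
Unshelve. all: by end_near. Qed.

(** Fatou's lemma: the quotients of the remainder by u^2k are nonnegative, have integrals at most C
    for small u, and converge to Y^2k / (2k)!. *)
Lemma integrable_of_bigO_cosR k :
  (forall u : R, mu.-integrable D (EFin \o (fun x => cosR k (u * Y x)))) ->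
  bigO0 k.*2 (fun u => Rintegral mu D (fun x => cosR k (u * Y x))) ->
  (forall y : R, 0 <= cosR k y) ->
  mu.-integrable D (EFin \o (fun x => Y x ^+ k.*2)).
Proof.
move=> ic /bigO0P[C C0 hC] c0.
have hn0 n : 0 < (harmonic n : R) by exact: harmonic_gt0.
pose f n x : R := cosR k (harmonic n * Y x) / (harmonic n) ^+ k.*2.
have f0 n x : 0 <= f n x by rewrite divr_ge0 ?exprn_ge0 ?(ltW (hn0 _)).
have mf n : measurable_fun D (f n) by apply: measurable_funM => //; exact: measurable_cosR.
have fcvg x : (fun n => f n x) @ \oo --> Y x ^+ k.*2 / k.*2`!%:R.
  (* [cosRS] isolates the limit; what is left is the quotient of the next remainder, which tends to
     0. *)
  have -> : (fun n => f n x) = (fun n => Y x ^+ k.*2 / k.*2`!%:R -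
      cosR k.+1 (harmonic n * Y x) / (harmonic n) ^+ k.*2).
    apply/funext => n; rewrite /f cosRS exprMn mulrBl opprB addrCA -[LHS]addr0.
    congr (_ + _); apply/esym/eqP; rewrite subr_eq0; apply/eqP.
    rewrite -[in RHS]mulrA mulrAC -[in RHS]mulrA mulrCA.
    have hk : harmonic n ^+ k.*2 != 0 :> R by rewrite expf_neq0 ?gt_eqF.
    by rewrite mulrA (divfK hk) [LHS]mulrC.
  rewrite -[X in _ --> X]subr0; apply: cvgB; first exact: cvg_cst.
  exact: cvg_cosR_quot.
have fint n : (\int[mu]_(x in D) (f n x)%:E)%E =
  (Rintegral mu D (fun x => cosR k (harmonic n * Y x)) / (harmonic n : R) ^+ k.*2)%:E.
  rewrite -RintegralZr// fineK//; apply: integrable_fin_num => //.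
  have := integrable_scale mD (harmonic n ^+ k.*2)^-1 (ic (harmonic n)).
  by congr (integrable _ _ (_ \o _)); apply/funext => x; rewrite mulrC.
have Yk0 x : 0 <= Y x ^+ k.*2 by rewrite exprn_even_ge0 ?odd_double.
have le_C : (\int[mu]_(x in D) (Y x ^+ k.*2 / k.*2`!%:R)%:E <= C%:E)%E.
  have -> : (\int[mu]_(x in D) (Y x ^+ k.*2 / k.*2`!%:R)%:E)%E =
      (\int[mu]_(x in D) limn_einf (fun n => (f n x)%:E))%E.
    apply: eq_integral => x _; apply/esym.
    by apply: (cvg_limn_einf_sup _).1; apply: cvg_EFin; [exact: nearW|exact: fcvg].
  apply: (le_trans (fatou mu mD _ _)).
  - by move=> n; exact/measurable_EFinP.
  - by move=> n x _; rewrite lee_fin.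
  rewrite limn_einf_lim; apply: lime_le; first exact: is_cvg_einfs.
  have [N _ hN] := near_harmonic hC.
  apply: nearW => n.
  (* The infimum over the tail from n is bounded by one of its terms, taken beyond N so that the O
     bound holds there. *)
  apply: (@le_trans _ _ (\int[mu]_(x in D) (f (maxn n N) x)%:E)%E).
    by apply: ereal_inf_lbound; exists (maxn n N) => //=; exact: leq_maxl.
  rewrite fint lee_fin ler_pdivrMr ?exprn_gt0//.
  have := hN (maxn n N) (leq_maxr _ _); rewrite /= -/(harmonic _) (gtr0_norm (hn0 _)).
  by apply: le_trans; exact: ler_norm.
have iq : mu.-integrable D (EFin \o (fun x => Y x ^+ k.*2 / k.*2`!%:R)).
  apply/integrableP; split.
    by apply/measurable_EFinP; apply: measurable_funM => //; exact: measurable_funX.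
  apply: le_lt_trans (ltry C); apply: le_trans le_C.
  rewrite le_eqVlt; apply/orP; left; apply/eqP; apply: eq_integral => x _ /=.
  by rewrite ger0_norm// divr_ge0.
have := integrable_scale mD k.*2`!%:R iq.
congr (integrable _ _ (_ \o _)); apply/funext => x.
by rewrite mulrC divfK// pnatr_eq0 -lt0n fact_gt0.
Qed.
End levy_moments.

(** * Moments of the Levy measure *)

Lemma cosR0 (R : realType) (y : R) : cosR 0 y = cos y.
Proof. by rewrite /cosR /cosP big_ord0 horner0 subr0 mul1r. Qed.

Lemma sinR0 (R : realType) (y : R) : sinR 0 y = sin y.
Proof. by rewrite /sinR /sinP big_ord0 horner0 subr0 mul1r. Qed.

Lemma cosR1 (R : realType) (y : R) : cosR 1 y = 1 - cos y.
Proof. by rewrite cosRS cosR0 expr0 fact0 divr1. Qed.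

Lemma sinR1 (R : realType) (y : R) : sinR 1 y = y - sin y.
Proof. by rewrite sinRS sinR0 expr1 divr1. Qed.

Lemma exprS_le_add (R : realType) (y : R) n : 0 <= y -> y ^+ n.+1 <= y ^+ n + y ^+ n.+2.
Proof.
move=> y0; rewrite !exprS mulrA -[X in X + _]mul1r -mulrDl ler_wpM2r ?exprn_ge0//.
nra.
Qed.

Section levy.
Context {R : realType} (nu : {measure set R -> \bar R}).
Local Notation D := (~` [set (0 : R)]).

Let mD : measurable D. Proof. exact: measurableC. Qed.

Hypothesis nuL : levy_measure nu.

Let min1 (x : R) : R := Num.min 1 (x ^+ 2).

Let imin1 : nu.-integrable D (EFin \o min1).
Proof.
have min0 x : 0 <= min1 x by rewrite le_min ler01 sqr_ge0.
have mmin : measurable_fun [set: R] min1.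
  by apply: measurable_minr => //; exact: measurable_funX.
apply: (@integrableS _ _ _ _ [set: R]) => //.
apply/integrableP; split; first exact/measurable_EFinP.
case: nuL => _; apply: le_lt_trans; rewrite le_eqVlt; apply/orP; left; apply/eqP.
by apply: eq_integral => x _ /=; rewrite ger0_norm.
Qed.

(** 1 - cos(ux) is at most 2 and at most u^2 x^2; the factor 2 + u^2 covers both cases. *)
Lemma cosR1_le_min (u x : R) : cosR 1 (u * x) <= (2 + u ^+ 2) * min1 x.
Proof.
have h2 : cosR 1 (u * x) <= 2 by rewrite cosR1; have := cos_geN1 (u * x); lra.
have h3 : cosR 1 (u * x) <= u ^+ 2 * x ^+ 2.
  have := cosR_le 1 (u * x); rewrite -[1.*2]/2%N exprMn => /le_trans; apply.
  by apply: ler_piMr; [rewrite mulr_ge0 ?sqr_ge0|exact: ge1_factV].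
have u2 : 0 <= u ^+ 2 by rewrite sqr_ge0.
have x2 : 0 <= x ^+ 2 by rewrite sqr_ge0.
rewrite /min1; have [_|_] := leP 1 (x ^+ 2).
  by rewrite mulr1 (le_trans h2)// lerDl.
by rewrite (le_trans h3)// mulrDl lerDr mulr_ge0.
Qed.

Lemma levy_integrable_cosR1 u : nu.-integrable D (EFin \o (fun x => cosR 1 (u * x))).
Proof.
apply: (integrable_le mD _ _ (integrable_scale mD (2 + u ^+ 2) imin1)).
  exact: (@measurable_cosR _ _ _ D id).
by move=> x _; rewrite ger0_norm ?cosR_ge0 ?cosR1_le_min.
Qed.

Lemma levy_Rintegral_cos u :
  Rintegral nu D (fun x => cos (u * x) - 1) = - Rintegral nu D (fun x => cosR 1 (u * x)).
Proof.
rewrite -[RHS]mulN1r -RintegralZl//; last exact: levy_integrable_cosR1.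
by apply: eq_Rintegral => x _; rewrite cosR1 mulN1r opprB.
Qed.

(** The hypothesis concerns the squared modulus of a characteristic function, whence the factor 2.
    Given the even moments of orders 2 to 2k, the doubled exponent is a polynomial q plus s, a
    signed multiple of the integrated remainder. Dominated convergence gives s = o(u^2k),
    [bigO0_log_even] improves this to O(u^(2k+2)), and [integrable_of_bigO_cosR] yields the next
    moment. *)
Lemma levy_even_moments (s2 : R) :
  (forall N, exists p, expand N (fun u => expR (2 * (- s2 * u ^+ 2 / 2 +
      Rintegral nu D (fun x => cos (u * x) - 1)))) p) ->
  forall k, nu.-integrable D (EFin \o (fun x : R => x ^+ k.+1.*2)).
Proof.
move=> hexp.
have [m [m0 mE]] : exists m : nat -> R, (forall j, (j < 1)%N -> m j.*2 = 0) /\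
    (forall j, (1 <= j)%N -> m j.*2 = Rintegral nu D (fun x => x ^+ j.*2)).
  exists (fun i => if i == 0%N then 0 else Rintegral nu D (fun x => x ^+ i)).
  by split; case.
(* Course-of-values form: the step needs all lower even moments at once. *)
suff H k j : (j < k)%N -> nu.-integrable D (EFin \o (fun x : R => x ^+ j.+1.*2)).
  by move=> k; exact: (H k.+1).
elim: k j => // k IH j; rewrite ltnS leq_eqVlt => /predU1P[->{j}|]; last exact: IH.
have mid : measurable_fun D (@id R) by exact: measurable_id.
have iY j : (1 <= j < k.+1)%N -> nu.-integrable D (EFin \o (fun x : R => x ^+ j.*2)).
  by case: j => // j; rewrite ltnS => jk; exact: IH.
have hR u := Rintegral_cosR mD (Y := id) (ltn0Sn k) (levy_integrable_cosR1 u) iY m0 mE.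
have ic u : nu.-integrable D (EFin \o (fun x => cosR k.+1 (u * x))) by have [] := hR u.
pose r u := Rintegral nu D (fun x => cosR k.+1 (u * x)).
pose s (u : R) : R := 2 * (-1) ^+ k.+1 * r u.
suff sO : bigO0 k.+1.*2 s.
  apply: (integrable_of_bigO_cosR mD mid ic) => [|y]; last exact: cosR_ge0.
  apply: bigO0_ext (bigO0Z (2^-1 * (-1) ^+ k.+1) sO) => u.
  rewrite /s /r mulrACA -!mulrA [(-1) ^+ _ * _]mulrA sign_sqr.
  by rewrite mul1r mulrA mulVf ?mul1r// pnatr_eq0.
(* The doubled exponent is q + s, so exp(s) expands as the product of its exponential and
   exp(-q). *)
pose q : {poly R} := - s2 *: 'X^2 + 2 *: cosP k.+1 m.
have [p hp] := hexp k.+1.*2.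
have q0 : (- q)`_0 = 0.
  by rewrite coefN coefD !coefZ coefXn coef_cosP0 ?(m0 0%N)//= !mulr0 addr0 oppr0.
have hq := expand_comp (isT : 0 < k.+1.*2)%N (expand_expR _)
  (expand_horner k.+1.*2 (- q)) q0.
have hs : expand k.+1.*2 (fun u => expR (s u))
    (p * (egf k.+1.*2 (fun=> 1) \Po - q)).
  apply: expand_ext (expandM hp hq) => u; rewrite -expRD; congr expR.
  rewrite levy_Rintegral_cos; have [_] := hR u; rewrite expr1 mulN1r => ->.
  by rewrite /q hornerN hornerD !hornerZ hornerXn /s /r; field.
apply: (bigO0_log_even _ hs).
  by move=> u; rewrite /s /r; congr (_ * _); apply: eq_Rintegral => x _; rewrite mulNr cosRN.
(* The dominating function is 3 min(1, x^2) at the first stage, as 2 + u^2 <= 3, and afterwards the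
   even power x^2k whose integrability was obtained at the previous stage. *)
have [g ig hg] : exists2 g : R -> R, nu.-integrable D (EFin \o g) &
    forall u x, 0 < u -> u <= 1 -> D x -> cosR k.+1 (u * x) <= u ^+ k.*2 * g x.
  clear -imin1 mD IH; case: k IH => [_|k IH].
    exists (fun x => 3 * min1 x); first exact: integrable_scale.
    move=> u x u0 u1 _; rewrite expr0 mul1r (le_trans (cosR1_le_min _ _))//.
    rewrite ler_wpM2r//; first by rewrite le_min ler01 sqr_ge0.
    have : u ^+ 2 <= 1 by rewrite exprn_ile1// ltW.
    by lra.
  exists (fun x => x ^+ k.+1.*2); first exact: IH.
  move=> u x _ _ _; rewrite cosRS -exprMn.
  rewrite (@le_trans _ _ ((u * x) ^+ k.+1.*2 / k.+1.*2`!%:R))//.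
    by rewrite gerBl cosR_ge0.
  rewrite ler_piMr ?ge1_factV//.
  by rewrite exprn_even_ge0 ?odd_double.
have -> : (fun n => s (harmonic n) / (harmonic n : R) ^+ k.*2) =
    (fun n => 2 * (-1) ^+ k.+1 * (r (harmonic n) / (harmonic n : R) ^+ k.*2)).
  by apply/funext => n; rewrite mulrA.
rewrite -[X in _ --> X](mulr0 (2 * (-1) ^+ k.+1)); apply: cvgMr.
exact: (cvg_Rintegral_cosR mD mid ig hg).
Qed.

(** An odd power is dominated by the sum of the two neighbouring even ones. *)
Lemma levy_moments (s2 : R) :
  (forall N, exists p, expand N (fun u => expR (2 * (- s2 * u ^+ 2 / 2 +
      Rintegral nu D (fun x => cos (u * x) - 1)))) p) ->
  forall j, nu.-integrable D (EFin \o (fun x : R => x ^+ j.+2)).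
Proof.
move=> /levy_even_moments iE j; have [oj|ej] := boolP (odd j); last first.
  by have := iE j./2; rewrite doubleS even_halfK.
have [i ->] : exists i, j = i.*2.+1 by exists j./2; rewrite -[LHS]odd_double_half oj.
apply: (integrable_le mD _ _ (integrable_add mD (iE i) (iE i.+1))).
  exact: measurable_funX.
move=> x _; rewrite !doubleS; set n := (i.*2).+2.
have n2 : ~~ odd n by rewrite /= negbK odd_double.
have xE k : ~~ odd k -> x ^+ k = `|x| ^+ k.
  by move=> ek; rewrite -normrX ger0_norm// exprn_even_ge0.
have n4 : ~~ odd n.+2 by rewrite /= !negbK odd_double.
rewrite normrX (xE n n2) (xE n.+2 n4).
exact: exprS_le_add.
Qed.

End levy.

(** * Cumulants from the Levy-Khintchine formula *)

Lemma eqX_texp_le (F : fieldType) N K (p q : {poly F}) : (N <= K)%N ->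
  p`_0 = 0 -> q`_0 = 0 -> eqX N p q -> eqX N (texp N p) (texp K q).
Proof.
move=> NK p0 q0 pq; apply: eqX_trans (eqX_texp p0 pq) _ => i iN.
(* The powers of index j >= N, present only in the longer exponential, have valuation at least N. *)
rewrite !texpE !coef_sum (big_ord_widen K (fun j => (j`!%:R^-1 *: q ^+ j)`_i))//.
rewrite big_mkcond; apply: eq_bigr => j _; case: ltnP => // Nj.
by rewrite coefZ coefX_low ?mulr0// (leq_trans iN).
Qed.

Lemma texp_coef1 (F : fieldType) N (p : {poly F}) : p`_0 = 0 -> (texp N.+2 p)`_1 = p`_1.
Proof.
move=> p0; rewrite texpE coef_sum !big_ord_recl big1 => [|i _]; last first.
  by rewrite coefZ coefX_low ?mulr0.
by rewrite !coefZ/= expr0 coefC/= mulr0 add0r addr0 expr1 invr1 mul1r.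
Qed.

Lemma egf_coef0 (F : fieldType) N (f : nat -> F) : f 0%N = 0 -> (egf N f)`_0 = 0.
Proof. by move=> f0; rewrite coef_poly f0 mul0r if_same. Qed.

Section LK_cumulants.
Context d (T : measurableType d) (R : realType) (P : probability T R).
Variables (Y : T -> R) (b s2 : R) (nu : {measure set R -> \bar R}).
Hypotheses (mY : measurable_fun setT Y)
  (iY : forall k, P.-integrable setT (EFin \o (fun w => Y w ^+ k)))
  (LK : LK_triple P Y b s2 nu).
Local Notation D := (~` [set (0 : R)]).

Let mom j := Rintegral P setT (fun w => Y w ^+ j).
Let large (x : R) : R := if `|x| <= 1 then 0 else x.
(** The first cumulant is the drift b freed from the cut-off at |x| <= 1; it is identified with the
    mean at the end. *)
Let cum (j : nat) : R := if j == 0%N then 0 else if j == 1%N then b + Rintegral nu D large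
  else if j == 2 then s2 + Rintegral nu D (fun x => x ^+ 2)
  else Rintegral nu D (fun x => x ^+ j).
Let re (u : R) : R := - s2 * u ^+ 2 / 2 + Rintegral nu D (fun x => cos (u * x) - 1).
Let im (u : R) := b * u + Rintegral nu D
  (fun x : R => sin (u * x) - (if `|x| <= 1 then u * x else 0)).

Let mD : measurable D. Proof. exact: measurableC. Qed.
Let nuL : levy_measure nu. Proof. by case: LK => _ []. Qed.

Let expand_re_char k :
  expand k.+1.*2 (fun u => Rintegral P setT (fun w => cos (u * Y w))) (cosP k.+1 mom).
Proof.
apply: expand_ext (@expand_Rintegral_cosR _ _ _ P _ measurableT Y mY 0 k mom _ _ _ _ _) => //.
- by move=> u; rewrite expr0 mul1r; apply: eq_Rintegral => w _; rewrite cosR0.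
- move=> u; apply: (integrable_le measurableT _ _ (iY 0)); first exact: measurable_cosR.
  by move=> w _; rewrite cosR0 expr0 ler_norml cos_geN1 cos_le1.
Qed.

Let expand_im_char k :
  expand k.+1.*2 (fun u => Rintegral P setT (fun w => sin (u * Y w))) (sinP k.+1 mom).
Proof.
apply: expand_ext (@expand_Rintegral_sinR _ _ _ P _ measurableT Y mY 0 k mom _ _ _ _ _) => //.
- by move=> u; rewrite expr0 mul1r; apply: eq_Rintegral => w _; rewrite sinR0.
- move=> u; apply: (integrable_le measurableT _ _ (iY 0)); first exact: measurable_sinR.
  by move=> w _; rewrite sinR0 expr0 ler_norml sin_geN1 sin_le1.
Qed.

(** The squares of the real and imaginary parts of the characteristic function add up to exp(2 re),
    the sine and cosine of im cancelling. The sum expands to every order because Y has all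
    moments. *)
Let inu j : nu.-integrable D (EFin \o (fun x : R => x ^+ j.+2)).
Proof.
apply: (@levy_moments _ _ nuL s2) => N.
exists (cosP N.+1 mom ^+ 2 + sinP N.+1 mom ^+ 2).
have NN : (N <= N.+1.*2)%N by rewrite (leq_trans (leqnSn N))// -addnn leq_addr.
apply: bigO0_le NN _.
apply: expand_ext (expandD (expandX 2 (expand_re_char N)) (expandX 2 (expand_im_char N))).
move=> u; case: LK => _ [_ /(_ u)] /= [-> ->].
by rewrite !exprMn -mulrDr cos2Dsin2 mulr1 -expRM_natl mulr_natl.
Qed.

Let expand_re k : expand k.+1.*2 re (cosP k.+1 cum).
Proof.
pose m j := if j == 0%N then 0 else Rintegral nu D (fun x => x ^+ j).
have h : expand k.+1.*2 (fun u => (-1) ^+ 1 * Rintegral nu D (fun x => cosR 1 (u * x)))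
    (cosP k.+1 m).
  apply: (@expand_Rintegral_cosR _ _ _ nu _ mD id) => //.
  - exact: levy_integrable_cosR1.
  - by case=> // j _; exact: inu.
  - by case.
  - by case.
have e : eqX k.+1.*2 (cosP k.+1 m + (- s2 / 2) *: 'X^2) (cosP k.+1 cum).
  (* At order 2 the Gaussian term, of degree 2, is invisible; at higher orders it joins the second
     cumulant. *)
  case: k {h} => [|k] i ik.
    rewrite /cosP !big_ord_recl !big_ord0/= !addr0 coefD !coefZ !coefXn.
    by case: i ik => [|[|]]//= _; rewrite !mulr0 addr0.
  apply: (congr1 (fun p : {poly R} => p`_i)); rewrite /cosP !big_ord_recl/= -!addrA.
  congr (_ + _).
  rewrite addrCA -scalerDl [RHS]addrC; congr (_ + _ *: _).
  by rewrite /m /cum/= /bump/= !factS fact0 expr1; field.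
apply: eq_expand e _.
apply: expand_ext (expandD h (expand_horner _ _)) => u.
by rewrite /re levy_Rintegral_cos// expr1 mulN1r hornerZ hornerXn addrC; congr (_ + _); ring.
Qed.

(** Second moments of nu control |x| beyond 1, so the compensator can be changed from the truncated
    ux to the full one: the integrand is u [large] x - [sinR] 1 (ux), and the integral of [large]
    goes into the drift. *)
Let expand_im k : expand k.+1.*2 im (sinP k.+1 cum).
Proof.
pose m j := if j == 1%N then 0 else Rintegral nu D (fun x => x ^+ j).
have ilarge : nu.-integrable D (EFin \o large).
  apply: (integrable_le mD _ _ (inu 0)).
    apply: measurable_funTS; apply: measurable_fun_ifT => //=.
    exact: measurable_fun_ler.
  move=> x _; rewrite /large; have [_|x1] := leP `|x| 1; first by rewrite normr0 sqr_ge0.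
  by rewrite -real_normK ?num_real// expr2 ler_peMl// ltW.
have is1 u : nu.-integrable D (EFin \o (fun x => sinR 1 (u * x))).
  apply: (integrable_le mD _ _ (integrable_scale mD (`|u| ^+ 3) (normr_integrable (inu 1)))).
    exact: (@measurable_sinR _ _ _ D id).
  move=> x _; rewrite (le_trans (sinR_norm_le _ _))// normrM exprMn normrX.
  by rewrite -[leRHS]mulr1 ler_pM ?ge1_factV ?invr_ge0// mulr_ge0 ?exprn_ge0.
have h : expand k.+1.*2 (fun u => (-1) ^+ 1 * Rintegral nu D (fun x => sinR 1 (u * x)))
    (sinP k.+1 m).
  apply: (@expand_Rintegral_sinR _ _ _ nu _ mD id) => //.
  - by case=> // j _; exact: inu.
  - by case.
  - by case.
have e : eqX k.+1.*2 (sinP k.+1 m + (b + Rintegral nu D large) *: 'X) (sinP k.+1 cum).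
  move=> i ik; apply: (congr1 (fun p : {poly R} => p`_i)); rewrite /sinP !big_ord_recl/= addrAC.
  congr (_ + _).
  by rewrite /m /cum/= mulr0 mul0r scale0r add0r expr0 mul1r divr1 expr1.
apply: eq_expand e _.
apply: expand_ext (expandD h (expand_horner _ _)) => u.
rewrite expr1 hornerZ hornerX /im.
have -> : Rintegral nu D (fun x : R => sin (u * x) - (if `|x| <= 1 then u * x else 0)) =
    Rintegral nu D (fun x => u * large x - sinR 1 (u * x)).
  apply: eq_Rintegral => x _; rewrite sinR1 /large.
  by case: ifP => _; ring.
rewrite RintegralB//; last exact: integrable_scale.
by rewrite RintegralZl//; ring.
Qed.

(** Both sides of the formula are expanded, the right one by composing the series of exp, cos and
    sin with those of re and im. Uniqueness of coefficients gives the two identities that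
    [egf_texp_of_cos_sin] combines. *)
Let egf_mom_cum k : eqX k.+1.*2 (egf k.+1.*2 mom) (texp k.+1.*2 (egf k.+1.*2 cum)).
Proof.
have c0 : (cosP k.+1 cum)`_0 = 0 by exact: coef_cosP0.
have s0 : (sinP k.+1 cum)`_0 = 0 by exact: coef_sinP0.
have k0 : (0 < k.+1.*2)%N by [].
have hexp := expand_comp k0 (expand_expR _) (expand_re k) c0.
apply: egf_texp_of_cos_sin => //.
  apply: expand_uniq (expand_re_char k) _.
  apply: expand_ext (expandM hexp (expand_comp k0 (expand_cos k) (expand_im k) s0)).
  by move=> u; case: LK => _ [_ /(_ u)] /= [-> _].
apply: expand_uniq (expand_im_char k) _.
apply: expand_ext (expandM hexp (expand_comp k0 (expand_sin k) (expand_im k) s0)).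
by move=> u; case: LK => _ [_ /(_ u)] /= [_ ->].
Qed.

Lemma LK_cumulants k : Rintegral P setT Y = 0 ->
  eqX k.+1.*2 (egf k.+1.*2 (fun j => Rintegral P setT (fun w => Y w ^+ j)))
    (texp k.+1.*2 (egf k.+1.*2 (fun j => if (j < 2)%N then 0
       else if j == 2 then s2 + Rintegral nu D (fun x => x ^+ 2)
       else Rintegral nu D (fun x => x ^+ j)))).
Proof.
move=> Y0; have h := @egf_mom_cum k.
(* In degree 1 the identity says that the first cumulant is the mean. *)
have cum1 : cum 1 = 0.
  have /esym := h 1%N isT; rewrite doubleS texp_coef1 ?egf_coef0// !coef_poly/= !divr1.
  by move=> ->; rewrite /mom -[RHS]Y0; apply: eq_Rintegral => w _; rewrite expr1.
suff <- : egf k.+1.*2 cum = egf k.+1.*2 (fun j => if (j < 2)%N then 0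
    else if j == 2 then s2 + Rintegral nu D (fun x => x ^+ 2)
    else Rintegral nu D (fun x => x ^+ j)) by exact: h.
apply/polyP => i; rewrite !coef_poly; case: ifP => // _; congr (_ / _).
by case: i => [|[|i]].
Qed.

End LK_cumulants.

(** * Independence *)

Section independence.
Context d (T : measurableType d) (R : realType) (P : probability T R).

(** Both sides are finite measures in A that agree on a generating pi-system containing the whole
    space. *)
Lemma indep_g_sigma_algebra (G : set (set T)) (E : set T) : measurable E ->
  G `<=` measurable -> setI_closed G -> G setT ->
  (forall A, G A -> P (A `&` E) = (P A * P E)%E) ->
  forall A, <<s G >> A -> P (A `&` E) = (P A * P E)%E.
Proof.
move=> mE mG GI GT PG A GA.
have PE0 : 0 <= fine (P E) by rewrite fine_ge0.
have -> : (P A * P E)%E = mscale (NngNum PE0) P A.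
  by rewrite /mscale/= fineK ?fin_num_measure// muleC.
have -> : P (A `&` E) = mrestr P mE A by [].
apply: (g_sigma_algebra_measure_unique G mG (fun=> setT)) => //.
- by rewrite bigcup_const.
- by move=> B GB; rewrite /= /mrestr /mscale/= fineK ?fin_num_measure// muleC PG.
- by move=> _; rewrite /= /mrestr (le_lt_trans (probability_le1 _ _)) ?ltry//; exact: measurableI.
Qed.

(** Independence makes the joint law of (Y, Z) the product of the two laws; the integral of the
    product is then computed by Fubini's theorem. *)
Lemma indep_integral_mul (Y Z : {mfun T >-> R}) :
  (forall B C, measurable B -> measurable C ->
     P ((Y @^-1` B) `&` (Z @^-1` C)) = (P (Y @^-1` B) * P (Z @^-1` C))%E) ->
  P.-integrable setT (EFin \o Y) -> P.-integrable setT (EFin \o Z) ->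
  P.-integrable setT (EFin \o (fun w => Y w * Z w)) /\
  Rintegral P setT (fun w => Y w * Z w) = Rintegral P setT Y * Rintegral P setT Z.
Proof.
move=> YZ iY iZ.
pose W w : R * R := (Y w, Z w).
have mW : measurable_fun setT W by exact: measurable_fun_pair.
pose Wm : {mfun T >-> (R * R)%type} := HB.pack W (isMeasurableFun.Build _ _ _ _ _ mW).
pose m1 := distribution P Y; pose m2 := distribution P Z.
have WE A : measurable A -> (m1 \x m2)%E A = distribution P Wm A.
  by apply: product_measure_unique => B C mB mC; rewrite /m1 /m2 /distribution /pushforward -YZ.
pose f (z : R * R) : \bar R := (z.1 * z.2)%:E.
have mf : measurable_fun setT f.
  by apply/measurable_EFinP; apply: measurable_funM; [exact: measurable_fst|exact: measurable_snd].
have mabs : measurable_fun setT (fun y : R => `|y%:E|%E) by apply: measurableT_comp.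
have abs_lty (V : {mfun T >-> R}) : P.-integrable setT (EFin \o V) ->
    (\int[distribution P V]_y `|y%:E| < +oo)%E.
  by move=> /integrableP[_]; rewrite ge0_integral_distribution.
have if12 : (m1 \x m2)%E.-integrable setT f.
  apply/integrable12ltyP => //.
  have inner y : (\int[m2]_z `|f (y, z)| = `|y%:E| * \int[m2]_z `|z%:E|)%E.
    rewrite -ge0_integralZl//; apply: eq_integral => z _.
    by rewrite /f/= normrM EFinM.
  under eq_integral do rewrite inner.
  rewrite ge0_integralZr//; last exact: integral_ge0.
  by rewrite lte_mul_pinfty ?integral_ge0 ?abs_lty// ge0_fin_numE ?abs_lty// integral_ge0.
have ifP : P.-integrable setT (f \o W).
  apply/integrableP; split; first exact: (measurableT_comp mf mW).
  have -> : (\int[P]_w `|(f \o W) w| = \int[distribution P Wm]_z `|f z|)%E.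
    by rewrite ge0_integral_distribution//; apply: measurableT_comp.
  rewrite (@eq_measure_integral _ _ _ _ (m1 \x m2)%E); last first.
    by move=> A mA _; apply/esym; exact: WE.
  by case/integrableP: if12.
split; first exact: ifP.
have intE (V : {mfun T >-> R}) : P.-integrable setT (EFin \o V) ->
    (\int[distribution P V]_y y%:E = (Rintegral P setT V)%:E)%E.
  move=> iV; rewrite integral_distribution//.
  by rewrite /Rintegral fineK//; exact: integrable_fin_num.
have intV (V : {mfun T >-> R}) : P.-integrable setT (EFin \o V) ->
    (distribution P V).-integrable setT (EFin : R -> \bar R).
  move=> iV; exact: integrable_pushforward.
have -> : Rintegral P setT (fun w => Y w * Z w) = fine (\int[P]_w (f \o Wm) w)%E by [].
rewrite -integral_distribution//.
rewrite (@eq_measure_integral _ _ _ _ (m1 \x m2)%E); last by move=> A mA _; apply/esym; exact: WE.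
rewrite -integral12_prod_meas1// /fubini_F.
have inner y : (\int[m2]_z f (y, z) = y%:E * (Rintegral P setT Z)%:E)%E.
  by rewrite -intE// -integralZl//; exact: intV.
under eq_integral do rewrite inner.
by rewrite integralZr//; [rewrite intE|exact: intV].
Qed.

End independence.

(** The times of l are sorted together with 0 and s: the grid starts where X vanishes, and its last
    step goes from s to t. *)
Lemma increasing_grid (R : realType) (s t : R) (l : seq R) : 0 <= s -> s < t ->
  (forall x, x \in l -> 0 <= x <= s) ->
  exists n (tau : nat -> R), [/\ tau 0%N = 0, tau n = s, tau n.+1 = t,
    (forall i, (i < n.+1)%N -> tau i < tau i.+1) &
    forall x, x \in l -> exists2 j, (j <= n)%N & tau j = x].
Proof.
move=> s0 st ls; pose L := sort <=%R (undup [:: 0, s & l]).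
have memL x : (x \in L) = (x \in [:: 0, s & l]) by rewrite mem_sort mem_undup.
have L0s x : x \in L -> 0 <= x <= s.
  rewrite memL !inE => /or3P[/eqP->|/eqP->|/ls//]; by rewrite lexx ?s0.
have srt : sorted <%R L by rewrite sort_lt_sorted undup_uniq.
have [n sL] : exists n, size L = n.+1.
  have : 0 \in L by rewrite memL inE eqxx.
  by case: (L) => // x L' _; exists (size L').
(* The default value t is the point of index n + 1, just past the end of L. *)
pose tau := nth t L; exists n, tau.
have tauS i : (i < n)%N -> tau i < tau i.+1.
  by move=> i_n; rewrite /tau (lt_sorted_ltn_nth t srt) ?inE ?sL// ltnS ltnW.
have mon i j : (i <= j)%N -> (j <= n)%N -> tau i <= tau j.
  move=> ij jn; rewrite /tau (lt_sorted_leq_nth t srt) ?inE ?sL//.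
  by rewrite ltnS (leq_trans ij).
have tau_in i : (i <= n)%N -> 0 <= tau i <= s.
  by move=> i_n; apply/L0s/mem_nth; rewrite sL ltnS.
have ex x : x \in L -> exists2 j, (j <= n)%N & tau j = x.
  by move=> xL; exists (index x L); [rewrite -ltnS -sL index_mem|rewrite /tau nth_index].
have tau0 : tau 0%N = 0.
  have [|j jn j0] := ex 0; first by rewrite memL inE eqxx.
  apply/eqP; rewrite eq_le; have /andP[-> _] := tau_in 0%N (leq0n _).
  by rewrite andbT -[leRHS]j0 mon.
have taun : tau n = s.
  have [|j jn js] := ex s; first by rewrite memL !inE eqxx orbT.
  apply/eqP; rewrite eq_le; have /andP[_ ->] := tau_in n (leqnn _).
  by rewrite /= -{1}js mon.
have taut : tau n.+1 = t by rewrite /tau nth_default// sL.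
split=> //.
- move=> i; rewrite ltnS leq_eqVlt => /predU1P[->|/tauS//].
  by rewrite taun taut.
- by move=> x xl; apply: ex; rewrite memL !inE xl !orbT.
Qed.

Section filtration_independence.
Context d (T : measurableType d) (R : realType) (P : probability T R).
Variable X : R -> T -> R.
Hypotheses (mX : forall t, 0 <= t -> measurable_fun setT (X t))
  (X0 : forall w, X 0 w = 0) (iX : indep_increments P X).

Let mincr a b (B : set R) : 0 <= a -> 0 <= b -> measurable B ->
  measurable [set w | B (X b w - X a w)].
Proof.
move=> a0 b0 mB; rewrite -[X in measurable X]setTI.
exact: (measurable_funB (mX b0) (mX a0)).
Qed.

Section grid.
Variables (tau : nat -> R) (n : nat).
Hypotheses (tau0 : tau 0%N = 0) (tauS : forall i, (i < n.+1)%N -> tau i < tau i.+1).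

Let tau_ge0 i : (i <= n.+1)%N -> 0 <= tau i.
Proof.
elim: i => [_|i IH ni]; first by rewrite tau0.
by rewrite (le_trans (IH (ltnW ni)))// ltW// tauS.
Qed.

Let box (B : nat -> set R) : set T :=
  \big[setI/setT]_(i < n) [set w | B i (X (tau i.+1) w - X (tau i) w)].
Let boxes : set (set T) := [set A | exists2 B, (forall i, measurable (B i)) & A = box B].

Let boxP B w : box B w <-> forall i, (i < n)%N -> B i (X (tau i.+1) w - X (tau i) w).
Proof.
by rewrite /box -(bigcap_mkord n (fun i => [set w | B i (X (tau i.+1) w - X (tau i) w)])).
Qed.

(** Boxes over one grid are stable under intersection, and on a box the claim follows by comparing
    the independence of n + 1 increments with that of the first n. *)
Lemma indep_last_increment (B : set R) : measurable B ->
  let E := [set w | B (X (tau n.+1) w - X (tau n) w)] in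
  forall A, <<s boxes >> A -> P (A `&` E) = (P A * P E)%E.
Proof.
move=> mB E; apply: indep_g_sigma_algebra.
- by apply: mincr => //; exact: tau_ge0.
- move=> _ [C mC ->]; apply: bigsetI_measurable => i _.
  by apply: mincr => //; apply: tau_ge0; [rewrite ltnW// ltnS ltnW|rewrite ltnS ltnW].
- move=> _ _ [C mC ->] [C' mC' ->]; exists (fun i => C i `&` C' i).
    by move=> i; exact: measurableI.
  apply/seteqP; split => w /=; rewrite !boxP.
    by move=> [h1 h2] i i_n; split; [exact: h1|exact: h2].
  by move=> h; split => i i_n; case: (h i i_n).
- exists (fun=> setT) => //; apply/seteqP; split => w //= _.
  by apply/boxP.
- move=> _ [C mC ->].
  (* B becomes the side of index n of a longer box. *)
  pose C' i := if i == n then B else C i.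
  have mC' i : measurable (C' i) by rewrite /C'; case: ifP.
  have t00 : 0 <= tau 0%N by rewrite tau0.
  have := iX t00 tauS mC'.
  rewrite !big_ord_recr/= [in X in X -> _](_ : C' n = B); last by rewrite /C' eqxx.
  have h1 : \big[setI/setT]_(i < n) [set w | C' i (X (tau i.+1) w - X (tau i) w)] = box C.
    by apply: eq_bigr => i _; rewrite /C' ltn_eqF.
  have h2 : (\prod_(i < n) P [set w | C' i (X (tau i.+1) w - X (tau i) w)%R] =
      \prod_(i < n) P [set w | C i (X (tau i.+1) w - X (tau i) w)%R])%E.
    by apply: eq_bigr => i _; rewrite /C' ltn_eqF.
  rewrite h1 h2 => ->; congr (_ * _)%E; apply/esym; apply: (iX t00 _ mC).
  by move=> i i_n; apply: tauS; exact: ltnW.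
Qed.

(** X at a grid point is the sum of the preceding increments, as X starts from 0. *)
Lemma measurable_grid j : (j <= n)%N ->
  measurable_fun (setT : set (g_sigma_algebraType boxes)) (X (tau j)).
Proof.
elim: j => [_|j IH jn].
  rewrite tau0; have -> : X 0 = cst 0 by apply/funext => w; rewrite X0.
  exact: measurable_cst.
have -> : X (tau j.+1) = (fun w => X (tau j) w + (X (tau j.+1) w - X (tau j) w)).
  by apply/funext => w; rewrite addrC subrK.
apply: measurable_funD; first by apply: IH; exact: ltnW.
move=> _ B mB; rewrite setTI; apply: sub_sigma_algebra.
exists (fun i => if i == j then B else setT); first by move=> i; case: ifP.
apply/seteqP; split => w /=.
  by move=> Bw; apply/boxP => i _; case: eqP => [->|].
by move=> /boxP/(_ j jn); rewrite eqxx.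
Qed.

Lemma indep_grid_increment (B : set R) (l : seq (R * set R)) : measurable B ->
  (forall p, List.In p l -> measurable p.2 /\ exists2 j, (j <= n)%N & tau j = p.1) ->
  let E := [set w | B (X (tau n.+1) w - X (tau n) w)] in
  let A := \big[setI/setT]_(p <- l) (X p.1 @^-1` p.2) in
  P (A `&` E) = (P A * P E)%E.
Proof.
move=> mB hl E A; apply: indep_last_increment => //.
rewrite {}/A; elim: l hl => [_|p l IH hl].
  by rewrite big_nil; exact: (@measurableT _ (g_sigma_algebraType boxes)).
rewrite big_cons; apply: (@measurableI _ (g_sigma_algebraType boxes)); last first.
  by apply: IH => q ql; apply: hl; right.
have [mp [j jn <-]] := hl p (or_introl erefl).
by have := measurable_grid jn measurableT mp; rewrite setTI.
Qed.

End grid.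

(* Boxes of increments over different grids do not form a pi-system, so the pi-lambda
   argument is run twice: on a fixed grid, and then on the finite-dimensional cylinders,
   each of which lives on a single grid. *)
Lemma indep_natural_filtration (s t : R) (B : set R) (A : set T) :
  0 <= s -> s < t -> measurable B -> natural_filtration X s A ->
  P (A `&` [set w | B (X t w - X s w)]) = (P A * P [set w | B (X t w - X s w)%R])%E.
Proof.
move=> s0 st mB.
pose ok (p : R * set R) := 0 <= p.1 <= s /\ measurable p.2.
pose G : set (set T) := [set A | exists2 l : seq (R * set R),
  (forall p, List.In p l -> ok p) & A = \big[setI/setT]_(p <- l) (X p.1 @^-1` p.2)].
have mE : measurable [set w | B (X t w - X s w)].
  by apply: mincr => //; rewrite (le_trans s0)// ltW.
have sub : natural_filtration X s `<=` <<s G >>.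
  apply: sub_sigma_algebra2 => _ [r [C [rs mC ->]]].
  exists [:: (r, C)]; last by rewrite big_seq1.
  by move=> p [<-|[]].
move=> /sub; apply: indep_g_sigma_algebra => //.
- move=> _ [l hl ->]; elim: l hl => [_|p l IH hl]; first by rewrite big_nil.
  rewrite big_cons; apply: measurableI; last by apply: IH => q ql; apply: hl; right.
  have [/andP[p0 _] mp] := hl p (or_introl erefl).
  by rewrite -[X in measurable X]setTI; exact: mX.
- move=> _ _ [l hl ->] [l' hl' ->]; exists (l ++ l'); last by rewrite big_cat.
  by move=> p /List.in_app_iff[/hl|/hl'].
- by exists [::] => //; rewrite big_nil.
- move=> _ [l hl ->].
  have ls x : x \in map fst l -> 0 <= x <= s.
    elim: l hl => // p l IH hl; rewrite inE => /predU1P[->|].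
      by case: (hl p (or_introl erefl)).
    by apply: IH => q ql; apply: hl; right.
  have [n [tau [tau0 taun taut tauS ex]]] := increasing_grid s0 st ls.
  rewrite -taun -taut; apply: (indep_grid_increment tau0 tauS mB).
  move=> p pl; split; first by case: (hl p pl).
  apply: ex; elim: l pl {hl ls} => // q l IH [->|/IH]; rewrite inE ?eqxx//.
  by move=> ->; rewrite orbT.
Qed.

End filtration_independence.

(** * The martingale property *)

(** The exponent is xu minus the series of f, so the exponential factors as exp(xu) times one
    independent of x; the sum is the Cauchy product. The order K > n is free so as to match that of
    the moment identities. *)
Lemma kendall_egf (F : fieldType) (n K : nat) (x : F) (f g : nat -> F) :
  (forall i : nat, i.+1%:R != 0 :> F) -> (n < K)%N ->
  f 0%N = 0 -> f 1%N = 0 -> (forall j, (2 <= j)%N -> f j = g j) ->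
  kendall n (fun k => if k == 1%N then x else - g k) =
  n`!%:R * \sum_(j < n.+1) x ^+ j / j`!%:R * (texp K (- egf K f))`_(n - j).
Proof.
move=> char0 nK f0 f1 fg; rewrite /kendall; congr (_ * _).
set p := \poly_(k < n.+1) _; rewrite -texpE.
have e0 : (- egf K f)`_0 = 0 by rewrite coefN egf_coef0 ?oppr0.
have x0 : (x *: 'X)`_0 = 0 by rewrite coefZ coefX mulr0.
have p0 : p`_0 = 0 by rewrite coef_poly.
have pE : eqX n.+1 p (x *: 'X - egf K f).
  move=> i; rewrite /p coefD coefN coefZ coefX !coef_poly => i_n.
  rewrite i_n (leq_trans i_n nK); case: i {i_n} => [|[|i]] /=.
  - by rewrite f0 mulr0 mul0r subr0.
  - by rewrite f1 mul0r subr0 divr1 mulr1.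
  - by rewrite mulr0 sub0r fg// mulNr.
have q0 : (x *: 'X - egf K f)`_0 = 0 by rewrite coefD x0 e0 addr0.
rewrite (eqX_texp_le nK p0 q0 pE)// (texpD char0 x0 e0)// texpZX coefM.
apply: eq_bigr => j _; rewrite coef_poly (leq_trans (ltn_ord j) nK).
by [].
Qed.

Lemma egf_binomial (F : fieldType) (K : nat) (a b c : nat -> F) :
  (forall i : nat, i.+1%:R != 0 :> F) ->
  (forall k, c k = \sum_(i < k.+1) 'C(k, i)%:R * a i * b (k - i)%N) ->
  eqX K (egf K c) (egf K a * egf K b).
Proof.
move=> char0 cE k kK; rewrite coefM coef_poly kK cE mulr_suml; apply: eq_bigr => i _.
have ik : (i <= k)%N by rewrite -ltnS.
rewrite !coef_poly (leq_ltn_trans ik kK) (leq_ltn_trans (leq_subr _ _) kK).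
have nz m : (m`!)%:R != 0 :> F by have := fact_gt0 m; case: (m`!).
have := bin_fact ik => /(congr1 (fun k => k%:R : F)); rewrite !natrM => e.
have := nz k; rewrite -e !mulf_eq0 !negb_or => /and3P[c0 i0 k0].
by field; rewrite c0 i0 k0.
Qed.

Lemma texpVr (F : fieldType) N (p : {poly F}) : (forall i : nat, i.+1%:R != 0 :> F) ->
  p`_0 = 0 -> eqX N (texp N p * texp N (- p)) 1.
Proof.
case: N => // N char0 p0; have p0' : (- p)`_0 = 0 by rewrite coefN p0 oppr0.
by have := eqX_sym (texpD (N := N.+1) char0 p0 p0'); rewrite subrr texp0.
Qed.

Lemma EFin_Rintegral d (T : measurableType d) (R : realType)
    (mu : {measure set T -> \bar R}) (D : set T) (f : T -> R) : measurable D ->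
  mu.-integrable D (EFin \o f) -> (\int[mu]_(x in D) (f x)%:E = (Rintegral mu D f)%:E)%E.
Proof. by move=> mD fi; rewrite fineK//; exact: integrable_fin_num. Qed.

Section kendall_martingale.
Context d (T : measurableType d) (R : realType) (P : probability T R).
Variables (X : R -> T -> R) (b s2 : R -> R) (nu : R -> {measure set R -> \bar R}).
Hypotheses (mX : forall t, 0 <= t -> measurable_fun setT (X t))
  (X0 : forall w, X 0 w = 0) (indX : indep_increments P X)
  (EX0 : forall t, 0 <= t -> (\int[P]_w (X t w)%:E = 0)%E)
  (momX : forall t (k : nat), 0 <= t -> (1 <= k)%N ->
     (\int[P]_w (`|X t w| ^+ k)%:E < +oo)%E)
  (LKX : forall t, 0 <= t -> LK_triple P (X t) (b t) (s2 t) (nu t)).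

Let char0 (i : nat) : i.+1%:R != 0 :> R. Proof. by rewrite pnatr_eq0. Qed.

Let iX t k : 0 <= t -> P.-integrable setT (EFin \o (fun w => X t w ^+ k)).
Proof.
move=> t0; case: k => [|k].
  by under eq_fun do rewrite expr0; exact: finite_measure_integrable_cst.
apply/integrableP; split; first by apply/measurable_EFinP/measurable_funX/mX.
apply: le_lt_trans (momX t0 (ltn0Sn k)); rewrite le_eqVlt; apply/orP; left.
by apply/eqP; apply: eq_integral => w _ /=; rewrite normrX.
Qed.

Let cum t j : R := if (j < 2)%N then 0 else if j == 2
  then s2 t + Rintegral (nu t) (~` [set 0]) (fun x => x ^+ 2)
  else Rintegral (nu t) (~` [set 0]) (fun x => x ^+ j).

Variable n : nat.
(** A truncation order above n, of the even form in which [LK_cumulants] is stated. *)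
Let K := n.+1.*2.
Let nK : (n < K)%N. Proof. by rewrite /K -addnn ltn_addr. Qed.

(** Inverse modulo X^K of the moment generating series of X_t, as [mom_c] shows for t >= 0. *)
Let c t := texp K (- egf K (cum t)).
Let mom t j := Rintegral P setT (fun w => X t w ^+ j).
Let M t w := kendall n (fun k => if k == 1%N then X t w else - Fcum s2 nu k t).

Let mom_c t : 0 <= t -> eqX K (egf K (mom t) * c t) 1.
Proof.
move=> t0; have EX : Rintegral P setT (X t) = 0 by rewrite /Rintegral EX0.
have iXt k := @iX t k t0.
have h := @LK_cumulants _ _ _ _ _ _ _ _ (mX t0) iXt (LKX t0) n EX.
have e0 : (egf K (cum t))`_0 = 0 by exact: egf_coef0.
apply: (eqX_trans _ (@texpVr _ K _ char0 e0)).
exact: (eqXM h (@eqX_refl _ K (c t))).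
Qed.

Let M_sum t w :
  M t w = \sum_(j < n.+1) (n`!%:R / j`!%:R * (c t)`_(n - j)) * X t w ^+ j.
Proof.
rewrite /M (@kendall_egf _ _ K _ (cum t))//; last first.
  by case=> [|[|[|j]]].
by rewrite mulr_sumr; apply: eq_bigr => j _; ring.
Qed.

(** M is a polynomial in X_t with deterministic coefficients, so its integral over A is a
    coefficient of the series of the moments of X_t on A, divided by the generating series of
    X_t. *)
Let M_integrable t (A : set T) : 0 <= t -> measurable A ->
  P.-integrable A (EFin \o M t) /\
  Rintegral P A (M t) =
    n`!%:R * (egf K (fun j => Rintegral P A (fun w => X t w ^+ j)) * c t)`_n.
Proof.
move=> t0 mA; have iA k : P.-integrable A (EFin \o (fun w => X t w ^+ k)).
  by apply: integrableS (iX k t0).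
have -> : M t = (fun w => \sum_(j < n.+1) (n`!%:R / j`!%:R * (c t)`_(n - j)) * X t w ^+ j).
  by apply/funext => w; exact: M_sum.
have [i1 ->] := @integrable_sum_seq _ _ _ P A mA _ (index_enum 'I_n.+1)
  (fun j w => (n`!%:R / j`!%:R * (c t)`_(n - j)) * X t w ^+ j)
  (fun j => integrable_scale mA _ (iA j)).
split=> //; rewrite coefM mulr_sumr; apply: eq_bigr => j _.
rewrite RintegralZl// coef_poly (leq_trans (ltn_ord j) nK).
by ring.
Qed.

Let M_adapted t (B : set R) : 0 <= t -> measurable B ->
  natural_filtration X t (M t @^-1` B).
Proof.
move=> t0 mB; apply: sub_sigma_algebra.
pose p : {poly R} := \poly_(j < n.+1) (n`!%:R / j`!%:R * (c t)`_(n - j)).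
exists t, (horner p @^-1` B); split; first by rewrite t0 lexx.
  rewrite -[X in measurable X]setTI.
  have : measurable_fun setT (horner p).
    by apply: continuous_measurable_fun => x; exact: continuous_horner.
  exact.
apply/seteqP; split => w; rewrite /preimage/= M_sum horner_poly//.
Qed.

Let filtration_measurable s (A : set T) : natural_filtration X s A -> measurable A.
Proof.
rewrite -[X in _ -> X](_ : <<s (@measurable _ T) >> A = _); last first.
  by rewrite sigma_algebra_id//; exact: sigma_algebra_measurable.
apply: sub_sigma_algebra2 => _ [r [B [/andP[r0 _] mB ->]]].
by rewrite -[X in measurable X]setTI; exact: mX.
Qed.

Let increment_integrable s t k : 0 <= s -> 0 <= t ->
  P.-integrable setT (EFin \o (fun w => (X t w - X s w) ^+ k)).
Proof.
move=> s0 t0.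
apply: (integrable_le measurableT _ _ (integrable_scale measurableT (2 ^+ k)
  (integrable_add measurableT (normr_integrable (iX k t0)) (normr_integrable (iX k s0))))).
  by apply: measurable_funX; apply: measurable_funB; exact: mX.
move=> w _; rewrite !normrX.
(* By symmetry X_t is the larger in modulus, so that |X_t - X_s| <= 2 |X_t|; hence the constant
   2^k. *)
wlog : s t s0 t0 / `|X s w| <= `|X t w|.
  move=> h; have [/h->//|/ltW/h] := leP `|X s w| `|X t w|.
  by rewrite distrC [X in _ * X]addrC; exact.
move=> le_st; apply: (@le_trans _ _ ((2 * `|X t w|) ^+ k)).
  rewrite lerXn2r ?nnegrE ?mulr_ge0// (le_trans (ler_normB _ _))//.
  by rewrite mulr_natl mulr2n lerD2l.
by rewrite exprMn ler_wpM2l ?exprn_ge0// lerDl exprn_ge0.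
Qed.

(** X_t is expanded as X_s plus the increment. In each binomial term the indicator of A times a
    power of X_s belongs to the past, hence is independent of the power of the increment. *)
Let Rintegral_pow s t (A : set T) k : 0 <= s -> s < t -> natural_filtration X s A ->
  Rintegral P A (fun w => X t w ^+ k) =
  \sum_(i < k.+1) 'C(k, i)%:R * Rintegral P A (fun w => X s w ^+ i) *
     Rintegral P setT (fun w => (X t w - X s w) ^+ (k - i)).
Proof.
move=> s0 st FA; have t0 : 0 <= t by rewrite (le_trans s0)// ltW.
have mA := filtration_measurable FA.
have mkc f : Rintegral P A f = Rintegral P setT (fun w => \1_A w * f w).
  rewrite Rintegral_mkcond; apply: eq_Rintegral => w _.
  by rewrite /patch indicE; case: ifP; rewrite (mul1r, mul0r).
have key i j : P.-integrable setT (EFin \o (fun w => (\1_A w * X s w ^+ i) *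
      (X t w - X s w) ^+ j)) /\
    Rintegral P setT (fun w => (\1_A w * X s w ^+ i) * (X t w - X s w) ^+ j) =
    Rintegral P A (fun w => X s w ^+ i) * Rintegral P setT (fun w => (X t w - X s w) ^+ j).
  have mY : measurable_fun setT (fun w => \1_A w * X s w ^+ i : R).
    by apply: measurable_funM => //; apply: measurable_funX; exact: mX.
  have mI : measurable_fun setT (fun w => X t w - X s w).
    by apply: measurable_funB; exact: mX.
  have mZ : measurable_fun setT (fun w => (X t w - X s w) ^+ j) by exact: measurable_funX.
  pose Y : {mfun T >-> R} := HB.pack (fun w => \1_A w * X s w ^+ i : R)
    (isMeasurableFun.Build _ _ _ _ _ mY).
  pose Z : {mfun T >-> R} := HB.pack (fun w => (X t w - X s w) ^+ j)
    (isMeasurableFun.Build _ _ _ _ _ mZ).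
  have [|||h1 h2] := @indep_integral_mul _ _ _ P Y Z.
  - move=> B C mB mC.
    (* An event on the power of the increment is an event on the increment itself. *)
    have mC' : measurable ((fun x : R => x ^+ j) @^-1` C).
      rewrite -[X in measurable X]setTI.
      have mp : measurable_fun setT (fun x : R => x ^+ j) by exact: measurable_funX.
      exact: mp.
    apply: (@indep_natural_filtration _ _ _ P X mX X0 indX s t _ _ s0 st mC').
    pose G := [set A | exists r (B : set R),
      [/\ 0 <= r <= s, measurable B & A = X r @^-1` B] ].
    have mXs : measurable_fun (setT : set (g_sigma_algebraType G)) (X s).
      move=> _ D mD; rewrite setTI; apply: sub_sigma_algebra.
      by exists s, D; split => //; rewrite s0 lexx.
    have mYG : measurable_fun (setT : set (g_sigma_algebraType G))
        (fun w => \1_A w * X s w ^+ i : R).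
      by apply: measurable_funM; [exact: measurable_indic|exact: measurable_funX].
    by have := mYG measurableT _ mB; rewrite setTI.
  - apply: (integrable_le measurableT mY _ (normr_integrable (iX i s0))) => w _.
    by rewrite normrM indicE ler_piMl//; case: (_ \in _); rewrite ?normr1 ?normr0.
  - exact: increment_integrable.
  - by split => //; rewrite mkc -h2.
rewrite mkc.
have -> : (fun w => \1_A w * X t w ^+ k) = (fun w => \sum_(i < k.+1) 'C(k, i)%:R *
    ((\1_A w * X s w ^+ i) * (X t w - X s w) ^+ (k - i))).
  apply/funext => w; rewrite -[X t w in LHS](subrK (X s w)) exprDn mulr_sumr.
  by apply: eq_bigr => i _; rewrite -[_ *+ 'C(k, i)]mulr_natl; ring.
have [_ ->] := @integrable_sum_seq _ _ _ P setT measurableT _ (index_enum 'I_k.+1)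
  (fun i w => 'C(k, i)%:R * ((\1_A w * X s w ^+ i) * (X t w - X s w) ^+ (k - i)))
  (fun i => integrable_scale measurableT _ (key i (k - i)%N).1).
apply: eq_bigr => i _; have [k1 k2] := key i (k - i)%N.
by rewrite RintegralZl// k2 mulrA.
Qed.

Lemma kendall_martingale : martingale P X M.
Proof.
split; first by move=> t t0 B; exact: M_adapted.
split; first by move=> t t0; have [] := M_integrable t0 measurableT.
move=> s t s0; rewrite le_eqVlt => /predU1P[->//|st] A FA.
have t0 : 0 <= t by rewrite (le_trans s0)// ltW.
have mA := filtration_measurable FA.
have [is_ Es] := M_integrable s0 mA; have [it Et] := M_integrable t0 mA.
suff e : Rintegral P A (M t) = Rintegral P A (M s).
  by rewrite (EFin_Rintegral mA it) (EFin_Rintegral mA is_) e.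
rewrite Et Es; congr (_ * _).
pose z j := Rintegral P setT (fun w => (X t w - X s w) ^+ j).
have FT : natural_filtration X s setT by exact: (@measurableT _ (g_sigma_algebraType _)).
pose a B r j := Rintegral P B (fun w => X r w ^+ j).
have hA := @egf_binomial _ K (a A s) z (a A t) char0
  (fun k => @Rintegral_pow s t A k s0 st FA).
(* For the whole space as event, this is m_t = m_s z, with z the moment generating series of the
   increment. *)
have hT := @egf_binomial _ K (a setT s) z (a setT t) char0
  (fun k => @Rintegral_pow s t setT k s0 st FT).
rewrite (eqXM hA (@eqX_refl _ K (c t)) nK) -mulrA; set ez := egf K z.
suff zc : eqX K (ez * c t) (c s) by exact: (eqXM (@eqX_refl _ K (egf K (a A s))) zc nK).
have h1 : eqX K (egf K (mom s) * (ez * c t)) 1.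
  rewrite mulrA; apply: eqX_trans (mom_c t0).
  exact: (eqXM (eqX_sym hT) (@eqX_refl _ K (c t))).
have h2 := mom_c s0.
(* Uniqueness of the inverse of m_s: z c_t = z c_t (m_s c_s) = (m_s z c_t) c_s = c_s. *)
apply: (@eqX_trans _ _ (ez * c t * (egf K (mom s) * c s))).
  by rewrite -[X in eqX _ X]mulr1; exact: (eqXM (@eqX_refl _ K (ez * c t)) (eqX_sym h2)).
have -> : ez * c t * (egf K (mom s) * c s) = egf K (mom s) * (ez * c t) * c s by ring.
by rewrite -[X in eqX _ _ X]mul1r; exact: (eqXM h1 (@eqX_refl _ K (c s))).
Qed.

End kendall_martingale.

Unset Implicit Arguments. Set Strict Implicit. Set Printing Implicit Defensive.

Theorem theorem1 (R : realType) (d : measure_display) (T : measurableType d)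
  (P : probability T R) (X : R -> T -> R)
  (b s2 : R -> R) (nu : R -> {measure set R -> \bar R}) :
  (forall t, 0 <= t -> measurable_fun setT (X t)) ->
  (forall w, X 0 w = 0) ->
  indep_increments P X ->
  cont_in_prob P X ->
  (forall w, cadlag (fun t => X t w)) ->
  (forall t, 0 <= t -> (\int[P]_w (X t w)%:E = 0)%E) ->
  (forall t (k : nat), 0 <= t -> (1 <= k)%N ->
     (\int[P]_w (`|X t w| ^+ k)%:E < +oo)%E) ->
  (forall t, 0 <= t -> LK_triple P (X t) (b t) (s2 t) (nu t)) ->
  forall n : nat, (1 <= n)%N ->
  martingale P X (fun t w =>
    kendall n (fun k => if k == 1%N then X t w else - Fcum s2 nu k t)).
Proof.
move=> mX X0 indX _ _ EX0 momX LKX n _.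
exact: kendall_martingale EX0 momX LKX n.
Qed.
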